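(* Let $\{t_n\}_{n\in\mathbb{N}}\subset\mathbb{C}$ be a sequence with $\lim_{n\to\infty}|t_n|=\infty$ and let $\{c_n\}_{n\in\mathbb{N}}$ be a sequence of real numbers such that $$c_n>0\ \text{ and }\ |\arg t_n|<\frac{\pi}{8}\quad\text{for all } n\in\mathbb{N},$$ $$\sum_{n=1}^{\infty}\frac{c_n}{|t_n|}<+\infty,\qquad \sum_{n=1}^{\infty}\frac{1}{|t_n|^2}<+\infty .$$ Then the meromorphic function $f(z)=\sum_{n=1}^{\infty}\frac{c_n}{z-t_n}$ has at least one zero in $\mathbb{C}$.
   Context: $\arg$ denotes the principal argument, with values in $(-\pi,\pi]$; all $t_n$ are nonzero. Since $\sum_n c_n/|t_n|<+\infty$, the series defining $f$ converges absolutely and uniformly on compact subsets of $\mathbb{C}\setminus\{t_n\}_{n\in\mathbb{N}}$ and defines a meromorphic function in $\mathbb{C}$. *)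

(* Defs.v *)
From Stdlib Require Import Reals Lra.
From Coquelicot Require Import Coquelicot.

Local Open Scope R_scope.

(* Principal argument. The value at 0 is junk; for z <> 0, [Carg_bound] and
   [Carg_polar] below characterise it: it lies in (-PI, PI] and
   z = |z| (cos (Carg z) + i sin (Carg z)). *)
Definition Carg (z : C) : R :=
  if Rle_dec 0 (Im z) then acos (Re z / Cmod z) else - acos (Re z / Cmod z).

(* The graph of the meromorphic function f(z) = sum_n c_n / (z - t_n):
   "z is not a pole and f(z) = w". When all c_n > 0, every t_n is a genuine
   pole of f, even if values of t repeat (coefficients of coinciding terms add
   up to something positive), so a zero of f is a point where this holds with
   w = 0. *)
Definition is_pole_series (c : nat -> R) (t : nat -> C) (z w : C) : Prop :=
  (forall n, z <> t n) /\
  is_series (V := C_NormedModule) (fun n => (RtoC (c n) / (z - t n))%C) w.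

Lemma Cmod_sq (z : C) : Cmod z * Cmod z = Re z * Re z + Im z * Im z.
Proof.
unfold Cmod. rewrite sqrt_sqrt.
- unfold Re, Im; ring.
- pose proof (pow2_ge_0 (fst z)). pose proof (pow2_ge_0 (snd z)). lra.
Qed.

Lemma Re_div_Cmod_bound (z : C) : z <> 0%C -> -1 <= Re z / Cmod z <= 1.
Proof.
intros Hz.
pose proof (proj1 (Cmod_gt_0 z) Hz) as Hm.
pose proof (re_le_Cmod z) as H. apply Rabs_le_between in H.
split.
- apply Rmult_le_reg_r with (Cmod z); [exact Hm|].
  unfold Rdiv; rewrite Rmult_assoc, Rinv_l; lra.
- apply Rmult_le_reg_r with (Cmod z); [exact Hm|].
  unfold Rdiv; rewrite Rmult_assoc, Rinv_l; lra.
Qed.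

Lemma sqrt_Im (z : C) :
  z <> 0%C -> Cmod z * sqrt (1 - (Re z / Cmod z)²) = Rabs (Im z).
Proof.
intros Hz.
pose proof (proj1 (Cmod_gt_0 z) Hz) as Hm.
rewrite <- sqrt_Rsqr_abs.
rewrite <- (sqrt_square (Cmod z)) at 1 by lra.
rewrite <- sqrt_mult_alt by nra.
f_equal. pose proof (Cmod_sq z) as H.
replace (Cmod z * Cmod z * (1 - (Re z / Cmod z)²))
  with (Cmod z * Cmod z - Re z * Re z) by (unfold Rsqr; field; lra).
unfold Rsqr; lra.
Qed.

Lemma Carg_bound (z : C) : z <> 0%C -> - PI < Carg z <= PI.
Proof.
intros Hz. pose proof (acos_bound (Re z / Cmod z)) as Hb.
unfold Carg. destruct (Rle_dec 0 (Im z)) as [Hi | Hi].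
- pose proof PI_RGT_0; lra.
- pose proof PI_RGT_0. split; [| lra].
  destruct (Rle_lt_or_eq_dec _ _ (proj2 Hb)) as [Hlt | Heq]; [lra |].
  exfalso.
  pose proof (cos_acos _ (Re_div_Cmod_bound z Hz)) as Hc.
  rewrite Heq, cos_PI in Hc.
  pose proof (sqrt_Im z Hz) as Hs. rewrite <- Hc in Hs.
  replace (1 - (-1)²) with 0 in Hs by (unfold Rsqr; ring).
  rewrite sqrt_0, Rmult_0_r in Hs.
  pose proof (Rabs_no_R0 (Im z)). lra.
Qed.

Lemma Carg_polar (z : C) :
  z <> 0%C -> z = (Cmod z * cos (Carg z), Cmod z * sin (Carg z)).
Proof.
intros Hz.
pose proof (proj1 (Cmod_gt_0 z) Hz) as Hm.
pose proof (Re_div_Cmod_bound z Hz) as Hr.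
pose proof (sqrt_Im z Hz) as Hs.
assert (Hc : Cmod z * (Re z / Cmod z) = Re z) by (field; lra).
rewrite (surjective_pairing z) at 1. fold (Re z) (Im z).
unfold Carg; destruct (Rle_dec 0 (Im z)) as [Hi | Hi].
- rewrite cos_acos, sin_acos by exact Hr.
  rewrite Hc, Hs, Rabs_pos_eq by lra. reflexivity.
- rewrite cos_neg, sin_neg, cos_acos, sin_acos by exact Hr.
  rewrite Hc, Ropp_mult_distr_r_reverse, Hs, Rabs_left by lra.
  f_equal; ring.
Qed.

(* Main.v *)
(* Let f_N be the N-th partial sum and suppose that f has no zero. A limit of zeros of f_N would be a zero of f, so the zeros of f_N leave every disc; by the Gauss-Lucas argument they lie in the cone |Im z| <= Re z / 2, Re z > 0, which contains all t_n.
   Write f_N = a prod (z - w) / prod (z - t). For x > 0 the modulus of f_N(0) f_N(-2x) / f_N(-x)^2 is the quotient of the products of |1 - (x / (w + x))^2| over the zeros and of |1 - (x / (t + x))^2| over the poles. In the cone these factors are at most 1, and about exp (- x^2 / |w|^2) for large |w|. On the negative axis, f_N is bounded above by a constant and below by a multiple of 1 / (1 + x), uniformly in N.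
   Since sum 1 / |t_n|^2 converges, the poles contribute at most exp (o(x^2)), which forces S_N = sum 1 / |w|^2 -> 0: the zeros do not contribute in the limit. But each pole factor is O(1 / x), so three distinct poles already give a growth x^3 of the left-hand side, whose upper bound is of order x^2. *)

Require Import Defs.
From Stdlib Require Import Reals Lra Lia Arith List Classical ClassicalEpsilon.
From Coquelicot Require Import Coquelicot.
From mathcomp Require ssreflect ssrfun ssrbool eqtype ssrnat seq choice fintype.
From mathcomp Require bigop ssralg ssrnum poly complex Rstruct.
Import ListNotations.

Local Open Scope R_scope.

(** * Factorisation of the partial sums *)

Definition peval (l : list C) (z : C) : C :=
  fold_right (fun a v => (a + z * v)%C) (RtoC 0) l.

Definition rprod (l : list C) (z : C) : C :=
  fold_right (fun w v => ((z - w) * v)%C) (RtoC 1) l.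

(* The roots come from [complex R], a copy of [C] known to be algebraically closed. *)
Module FTA.
Import ssreflect ssrfun ssrbool eqtype ssrnat seq choice fintype.
Import bigop ssralg ssrnum poly complex Rstruct.
Import GRing.Theory.

Definition toC (z : complex R) : C := (complex.Re z, complex.Im z).
Definition ofC (z : C) : complex R := Complex (fst z) (snd z).
Lemma ofCK z : toC (ofC z) = z.
Proof. by case: z. Qed.

Lemma toCD a b : toC (a + b)%R = Cplus (toC a) (toC b).
Proof. by case: a b => [? ?] [? ?]. Qed.

Lemma toCB a b : toC (a - b)%R = Cminus (toC a) (toC b).
Proof. by case: a b => [? ?] [? ?]. Qed.

Lemma toCM a b : toC (a * b)%R = Cmult (toC a) (toC b).
Proof. by case: a b => [? ?] [? ?]. Qed.

(** The scalar [a] is the leading coefficient, and the zero polynomial is covered by [a = 0]. *)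
Lemma peval_factor (l : list C) :
  exists (a : C) (ws : list C), forall z, peval l z = Cmult a (rprod ws z).
Proof.
have [ws Hws] := closed_field_poly_normal (Poly (map ofC l) : {poly complex R}).
exists (toC (lead_coef (Poly (map ofC l)))), (map toC ws) => z.
have := congr1 (fun p : {poly complex R} => toC (p.[ofC z])%R) Hws.
rewrite hornerZ toCM => H.
have -> : peval l z = toC (Poly (map ofC l)).[ofC z]%R.
  rewrite horner_Poly; elim: l {Hws H} => [|a l IH] //=.
  by rewrite toCD toCM -IH !ofCK Cmult_comm Cplus_comm.
rewrite H; congr Cmult.
elim: ws {Hws H} => [|w ws IH]; first by rewrite big_nil hornerC.
by rewrite big_cons hornerM toCM IH hornerXsubC toCB ofCK.
Qed.
End FTA.

(** Only the existence of coefficients is recorded, so closure properties involve no degrees; this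
    suffices to apply [FTA.peval_factor]. *)
Definition is_pol (f : C -> C) : Prop :=
  exists l : list C, forall z, f z = peval l z.

Lemma is_pol_const (a : C) : is_pol (fun _ => a).
Proof. exists [a]; intros z; simpl; ring. Qed.

Lemma is_pol_scal (a : C) (f : C -> C) :
  is_pol f -> is_pol (fun z => a * f z)%C.
Proof.
intros [l Hl]; exists (map (Cmult a) l); intros z; rewrite Hl; clear Hl f.
induction l as [|b l IH]; simpl; [ring | rewrite <- IH; ring].
Qed.

Lemma is_pol_plus (f g : C -> C) :
  is_pol f -> is_pol g -> is_pol (fun z => f z + g z)%C.
Proof.
intros [l Hl] [k Hk].
assert (H : is_pol (fun z => peval l z + peval k z)%C).
{ clear f g Hl Hk; revert k; induction l as [|a l IH]; intros k.
  - exists k; intros z; simpl; ring.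
  - destruct k as [|b k].
    + exists (a :: l); intros z; simpl; ring.
    + destruct (IH k) as [m Hm].
      exists ((a + b)%C :: m); intros z; simpl; rewrite <- Hm; ring. }
destruct H as [m Hm]; exists m; intros z; rewrite Hl, Hk; apply Hm.
Qed.

Lemma is_pol_mul_lin (w : C) (f : C -> C) :
  is_pol f -> is_pol (fun z => (z - w) * f z)%C.
Proof.
intros Hf.
assert (H : is_pol (fun z => z * f z)%C).
{ destruct Hf as [l Hl]; exists (RtoC 0 :: l).
  intros z; simpl; rewrite Hl; ring. }
destruct (is_pol_plus _ _ H (is_pol_scal (- w)%C f Hf)) as [m Hm].
exists m; intros z; rewrite <- Hm; ring.
Qed.

Lemma is_pol_rprod (l : list C) : is_pol (rprod l).
Proof.
induction l as [|a l IH].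
- exact (is_pol_const _).
- exact (is_pol_mul_lin _ _ IH).
Qed.

Lemma rprod_neq0 (l : list C) (z : C) : ~ In z l -> rprod l z <> RtoC 0.
Proof.
induction l as [|a l IH]; intros H; simpl in *.
- apply C1_nz.
- apply Cmult_neq_0; [|tauto].
  intros E; apply H; left.
  replace a with (z - (z - a))%C by ring; rewrite E; ring.
Qed.

Lemma rprod_eq0 (l : list C) (z : C) : In z l -> rprod l z = RtoC 0.
Proof.
induction l as [|a l IH]; simpl; [easy|].
intros [-> | H]; [|rewrite (IH H)]; ring.
Qed.

(** * Partial fractions and their numerators *)

Definition psum (L : list (R * C)) (z : C) : C :=
  fold_right (fun p v => RtoC (fst p) / (z - snd p) + v)%C (RtoC 0) L.

Definition weights_pos (L : list (R * C)) : Prop :=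
  forall p, In p L -> 0 < fst p.

(** The numerator of [psum L] over the common denominator [rprod (map snd L)]. It is meaningful at
    the poles too, where [psum] takes junk values. *)
Fixpoint numer (L : list (R * C)) (z : C) : C :=
  match L with
  | [] => RtoC 0
  | p :: L' =>
      (RtoC (fst p) * rprod (map snd L') z + (z - snd p) * numer L' z)%C
  end.

Lemma is_pol_numer (L : list (R * C)) : is_pol (numer L).
Proof.
induction L as [|p L IH]; simpl.
- apply is_pol_const.
- apply is_pol_plus; [apply is_pol_scal, is_pol_rprod | now apply is_pol_mul_lin].
Qed.

Lemma psum_numer (L : list (R * C)) (z : C) :
  ~ In z (map snd L) -> (psum L z * rprod (map snd L) z)%C = numer L z.
Proof.
induction L as [|p L IH]; intros H; simpl in *.
- ring.
- rewrite <- IH by tauto.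
  assert (Hz : (z - snd p)%C <> RtoC 0).
  { intros E; apply H; left.
    replace (snd p) with (z - (z - snd p))%C by ring; rewrite E; ring. }
  field; exact Hz.
Qed.

(** At a simple pole the only surviving term is its weight times the product of the differences to
    the other poles. Hence no root of the numerator is lost to cancellation with the denominator. *)
Lemma numer_pole (L : list (R * C)) (z : C) :
  weights_pos L -> NoDup (map snd L) -> In z (map snd L) ->
  numer L z <> RtoC 0.
Proof.
induction L as [|p L IH]; simpl; intros Hc Hd Hi; [easy|].
apply NoDup_cons_iff in Hd as [Hd1 Hd2].
destruct (excluded_middle_informative (snd p = z)) as [E | E].
- subst z.
  replace (snd p - snd p)%C with (RtoC 0) by ring.
  rewrite Cmult_0_l, Cplus_0_r.
  apply Cmult_neq_0; [|now apply rprod_neq0].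
  intros H0; apply RtoC_inj in H0.
  pose proof (Hc p (or_introl eq_refl)); lra.
- destruct Hi as [Hi | Hi]; [easy|].
  rewrite (rprod_eq0 _ _ Hi), Cmult_0_r, Cplus_0_l.
  apply Cmult_neq_0.
  + intros H0; apply E.
    replace (snd p) with (z - (z - snd p))%C by ring; rewrite H0; ring.
  + apply IH; auto. intros q Hq; apply Hc; now right.
Qed.

Lemma psum_factor_nodup (L : list (R * C)) :
  weights_pos L -> NoDup (map snd L) ->
  exists (a : C) (ws : list C),
    (forall w, In w ws -> ~ In w (map snd L) /\ psum L w = RtoC 0) /\
    forall z, ~ In z (map snd L) ->
      (psum L z * rprod (map snd L) z)%C = (a * rprod ws z)%C.
Proof.
intros Hc Hd.
destruct (is_pol_numer L) as [l Hl].
destruct (FTA.peval_factor l) as (a & ws & Hw).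
exists a, ws; split.
- intros w Hi.
  assert (H0 : numer L w = RtoC 0).
  { rewrite Hl, Hw, (rprod_eq0 _ _ Hi); ring. }
  assert (Hn : ~ In w (map snd L)).
  { intros Hp; now apply (numer_pole L w Hc Hd Hp). }
  split; [exact Hn|].
  rewrite <- psum_numer in H0 by exact Hn.
  destruct (excluded_middle_informative (psum L w = RtoC 0)) as [E | E]; [exact E|].
  exfalso; revert H0; apply Cmult_neq_0; [exact E | now apply rprod_neq0].
- intros z Hz; rewrite psum_numer by exact Hz; now rewrite Hl, Hw.
Qed.

Lemma psum_app (L L' : list (R * C)) (z : C) :
  psum (L ++ L') z = (psum L z + psum L' z)%C.
Proof.
induction L as [|p L IH]; simpl; [ring | rewrite IH; ring].
Qed.

(** Weights of coinciding poles are added; being positive they cannot cancel, so no pole disappears.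
    This reduces the factorisation to distinct poles. *)
Lemma merge_poles (L : list (R * C)) :
  weights_pos L ->
  exists L', weights_pos L' /\ NoDup (map snd L') /\
    (forall x, In x (map snd L') <-> In x (map snd L)) /\
    forall z, psum L' z = psum L z.
Proof.
induction L as [|[c t] L IH]; intros Hc.
{ exists []; repeat split; auto. constructor. }
destruct IH as (L' & Hc' & Hd & Hi & Hs).
{ intros p Hp; apply Hc; now right. }
assert (Hc0 : 0 < c) by (apply (Hc (c, t)); now left).
destruct (excluded_middle_informative (In t (map snd L'))) as [Ht | Ht].
- pose proof Ht as Ht'.
  apply in_map_iff in Ht as ([c' t'] & E & Hin); simpl in E; subst t'.
  apply in_split in Hin as (L1 & L2 & ->).
  exists (L1 ++ (c + c', t) :: L2); split; [|split; [|split]].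
  + intros p Hp; apply in_app_or in Hp as [Hp | [<- | Hp]].
    * apply Hc', in_or_app; now left.
    * simpl. pose proof (Hc' (c', t) (in_elt _ _ _)) as H; simpl in H; lra.
    * apply Hc', in_or_app; right; now right.
  + rewrite map_app in *; exact Hd.
  + intros x. rewrite map_app in *; simpl in *. rewrite <- Hi.
    split; [tauto | intros [<- | H]; auto].
  + intros z; simpl; rewrite <- Hs, !psum_app; simpl; rewrite RtoC_plus.
    unfold Cdiv; ring.
- exists ((c, t) :: L'); split; [|split; [|split]]; simpl.
  + intros p [<- | Hp]; [exact Hc0 | now apply Hc'].
  + now constructor.
  + intros x; now rewrite Hi.
  + intros z; now rewrite Hs.
Qed.

Lemma psum_factor (L : list (R * C)) :
  weights_pos L ->
  exists (a : C) (ts ws : list C),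
    NoDup ts /\ (forall x, In x ts <-> In x (map snd L)) /\
    (forall w, In w ws -> ~ In w ts /\ psum L w = RtoC 0) /\
    forall z, ~ In z ts -> (psum L z * rprod ts z)%C = (a * rprod ws z)%C.
Proof.
intros Hc; destruct (merge_poles L Hc) as (L' & Hc' & Hd & Hi & Hs).
destruct (psum_factor_nodup L' Hc' Hd) as (a & ws & Hw & Hf).
exists a, (map snd L'), ws; split; [exact Hd|]; split; [exact Hi|].
split; intros z Hz; rewrite <- Hs; auto.
Qed.

(* [1 / (z - t)] and [z - t] have conjugate directions, so a half-plane through [z] that contains all poles forces every term of the sum to one side. *)
Lemma psum_half_plane (L : list (R * C)) (z : C) (a b : R) :
  weights_pos L -> L <> [] ->
  (forall p, In p L ->
     0 < a * (fst (snd p) - fst z) + b * (snd (snd p) - snd z)) ->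
  a * fst (psum L z) - b * snd (psum L z) < 0.
Proof.
assert (G : weights_pos L ->
  (forall p, In p L ->
     0 < a * (fst (snd p) - fst z) + b * (snd (snd p) - snd z)) ->
  a * fst (psum L z) - b * snd (psum L z) <= 0 /\
  (L <> [] -> a * fst (psum L z) - b * snd (psum L z) < 0)).
{ induction L as [|[c t] L IH]; intros Hc H.
  - simpl; split; [lra | easy].
  - destruct IH as [IH _].
    { intros p Hp; apply Hc; now right. }
    { intros p Hp; apply H; now right. }
    pose proof (Hc _ (or_introl eq_refl)) as Hc0.
    pose proof (H _ (or_introl eq_refl)) as Ht.
    simpl in Hc0, Ht.
    cbn [psum fold_right]. fold (psum L z).
    set (s := psum L z) in *.
    destruct z as [x y], t as [u v]; simpl in *.
    set (d := (x + - u) * ((x + - u) * 1) + (y + - v) * ((y + - v) * 1)).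
    assert (Hd : 0 < d).
    { unfold d; rewrite !Rmult_1_r; fold (Rsqr (x + - u)) (Rsqr (y + - v)).
      pose proof (Rle_0_sqr (x + - u)). pose proof (Rle_0_sqr (y + - v)).
      destruct (Req_dec x u) as [-> | Hx]; [destruct (Req_dec y v) as [-> | Hy]|].
      - lra.
      - assert (0 < Rsqr (y + - v)) by (apply Rsqr_pos_lt; lra). lra.
      - assert (0 < Rsqr (x + - u)) by (apply Rsqr_pos_lt; lra). lra. }
    match goal with |- ?A <= 0 /\ _ =>
      replace A with (a * fst s - b * snd s
        + - (c * ((a * (u - x) + b * (v - y)) / d))) by (field; lra) end.
    assert (0 < c * ((a * (u - x) + b * (v - y)) / d)).
    { apply Rmult_lt_0_compat; [exact Hc0|]. now apply Rdiv_lt_0_compat. }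
    split; [lra | intros _; lra]. }
intros; now apply G.
Qed.

(** The slope 1/2 is a rational bound above tan(π/8) = √2 - 1, and small enough to keep Re(z^2) at
    least 3/5 |z|^2. *)
Definition cone (z : C) : Prop :=
  0 < fst z /\ - fst z <= 2 * snd z <= fst z.

(** Gauss-Lucas: the cone is the intersection of three half-planes with inner normals (1, 0), (1,
    2), (1, -2). If [w] violated one of them, all poles would lie strictly on one side of a line
    through [w]. *)
Lemma psum_zero_cone (L : list (R * C)) (w : C) :
  weights_pos L -> L <> [] -> (forall p, In p L -> cone (snd p)) ->
  psum L w = RtoC 0 -> cone w.
Proof.
intros Hc Hn Ht Hw.
assert (H : forall a b,
  (forall t, cone t -> a * fst w + b * snd w < a * fst t + b * snd t) -> False).
{ intros a b H.
  pose proof (psum_half_plane L w a b Hc Hn) as G.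
  rewrite Hw in G; simpl in G.
  enough (a * 0 - b * 0 < 0) by lra.
  apply G; intros p Hp; specialize (H _ (Ht p Hp)); lra. }
unfold cone in *; split; [|split]; apply Rnot_lt_le || apply Rnot_le_lt; intros Hlt.
- apply (H 1 0); intros t Hct; lra.
- apply (H 1 2); intros t Hct; lra.
- apply (H 1 (-2)); intros t Hct; lra.
Qed.

(** * Multiplicative differences in a cone *)

Definition lsum {T : Type} (g : T -> R) (l : list T) : R :=
  fold_right (fun x v => g x + v) 0 l.

Definition lprod {T : Type} (g : T -> R) (l : list T) : R :=
  fold_right (fun x v => g x * v) 1 l.

Lemma lprod_pos {T : Type} (g : T -> R) (l : list T) :
  (forall x, In x l -> 0 < g x) -> 0 < lprod g l.
Proof.
induction l as [|a l IH]; simpl; intros H; [lra|].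
apply Rmult_lt_0_compat; auto.
Qed.

Lemma lprod_le {T : Type} (g h : T -> R) (l : list T) :
  (forall x, In x l -> 0 <= g x <= h x) -> lprod g l <= lprod h l.
Proof.
intros H.
enough (0 <= lprod g l <= lprod h l) by lra.
induction l as [|a l IH]; simpl; [lra|].
pose proof (H a (or_introl eq_refl)).
assert (0 <= lprod g l <= lprod h l) by (apply IH; intros x Hx; apply H; now right).
split; [apply Rmult_le_pos | apply Rmult_le_compat]; lra.
Qed.

Lemma lprod_exp {T : Type} (k : R) (g : T -> R) (l : list T) :
  lprod (fun x => exp (k * g x)) l = exp (k * lsum g l).
Proof.
induction l as [|a l IH]; simpl.
- now rewrite Rmult_0_r, exp_0.
- now rewrite IH, <- exp_plus, <- Rmult_plus_distr_l.
Qed.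

Lemma lprod_app {T : Type} (g : T -> R) (l l' : list T) :
  lprod g (l ++ l') = lprod g l * lprod g l'.
Proof. induction l as [|a l IH]; simpl; [|rewrite IH]; ring. Qed.

(** Dropping factors at most 1 can only enlarge the product. Since [l'] has no repetitions, each of
    its entries uses up a different occurrence in [l]. *)
Lemma lprod_incl {T : Type} (g : T -> R) (l l' : list T) :
  NoDup l' -> incl l' l -> (forall x, In x l -> 0 < g x <= 1) ->
  lprod g l <= lprod g l'.
Proof.
revert l; induction l' as [|a l' IH]; intros l Hd Hi Hg.
- clear Hd Hi; enough (0 < lprod g l <= 1) by (simpl; lra).
  induction l as [|b l IH]; simpl; [lra|].
  pose proof (Hg b (or_introl eq_refl)).
  assert (0 < lprod g l <= 1) by (apply IH; intros x Hx; apply Hg; now right).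
  split; [apply Rmult_lt_0_compat; lra|].
  rewrite <- (Rmult_1_l 1); apply Rmult_le_compat; lra.
- apply NoDup_cons_iff in Hd as [Ha Hd].
  destruct (in_split a l (Hi a (or_introl eq_refl))) as (l1 & l2 & ->).
  assert (Hl : lprod g (l1 ++ l2) <= lprod g l').
  { apply IH; [exact Hd | | ].
    - intros x Hx.
      pose proof (Hi x (or_intror Hx)) as H.
      apply in_app_or in H as [H | [-> | H]]; [| easy |]; apply in_or_app; auto.
    - intros x Hx; apply Hg.
      apply in_app_or in Hx as [H | H]; apply in_or_app; simpl; auto. }
  rewrite lprod_app in *; simpl.
  pose proof (Hg a (in_elt _ _ _)).
  replace (lprod g l1 * (g a * lprod g l2)) with (g a * (lprod g l1 * lprod g l2)) by ring.
  apply Rmult_le_compat_l; lra.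
Qed.

Lemma Cmod2 (z : C) : Cmod z ^ 2 = fst z ^ 2 + snd z ^ 2.
Proof. pose proof (Cmod_sq z) as H; unfold Re, Im in H; simpl; lra. Qed.

Lemma Cmod_rprod (l : list C) (z : C) :
  Cmod (rprod l z) = lprod (fun w => Cmod (z - w)) l.
Proof.
induction l as [|a l IH]; simpl; [apply Cmod_1 | now rewrite Cmod_mult, IH].
Qed.

(* [|1 - (x / (z + x))^2|^2], the second multiplicative difference of [y |-> |z + y|^2] along [0, x, 2x]. It kills the factor [exp (a y)] that prevents the plain product from converging. *)
Definition quot (x : R) (z : C) : R :=
  (Cmod (RtoC 0 - z) * Cmod (RtoC (- 2 * x) - z) / Cmod (RtoC (- x) - z) ^ 2) ^ 2.

Lemma quot_eq (x a b : R) : quot x (a, b) =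
  ((a ^ 2 + b ^ 2) * (a ^ 2 + b ^ 2 + 4 * a * x + 4 * x ^ 2))
  / (a ^ 2 + b ^ 2 + 2 * a * x + x ^ 2) ^ 2.
Proof.
unfold quot, Rdiv.
rewrite !Rpow_mult_distr, pow_inv, <- !pow_mult.
change (2 * 2)%nat with 4%nat.
replace (Cmod (RtoC (- x) - (a, b)) ^ 4)
  with ((Cmod (RtoC (- x) - (a, b)) ^ 2) ^ 2) by ring.
rewrite !Cmod2; simpl.
f_equal; [|f_equal]; ring.
Qed.

Lemma cone_bounds (a b x : R) : cone (a, b) -> 0 < x ->
  let s := a ^ 2 + b ^ 2 in
  0 < a /\ 0 < s /\ 3 / 5 * s <= a ^ 2 - b ^ 2 /\ 0 < a * x /\ 0 < x ^ 2.
Proof.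
unfold cone; simpl; intros [Ha Hb] Hx.
(* This yields the 3/5: a^2 - b^2 - 3/5 (a^2 + b^2) = 2/5 (a^2 - 4 b^2). *)
assert (4 * b ^ 2 <= a ^ 2).
{ assert (0 <= (a - 2 * b) * (a + 2 * b)) by (apply Rmult_le_pos; lra). nra. }
assert (0 < a * a) by nra. assert (0 <= b * b) by nra.
repeat split; nra.
Qed.

Lemma quot_pos (x : R) (z : C) : cone z -> 0 < x -> 0 < quot x z.
Proof.
destruct z as [a b]; intros Hz Hx.
destruct (cone_bounds a b x Hz Hx) as (Ha & Hs & Hd & Hax & Hx2).
rewrite quot_eq; set (s := a ^ 2 + b ^ 2) in *.
apply Rdiv_lt_0_compat; [apply Rmult_lt_0_compat | apply pow_lt]; lra.
Qed.

(** The numerator of [1 - quot] is 2 x^2 (a^2 - b^2) + x^4 + 4 a x^3, a sum of positive terms in the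
    cone. Only the first is kept, and 6/5 is twice 3/5. *)
Lemma quot_defect (x a b : R) : cone (a, b) -> 0 < x ->
  let s := a ^ 2 + b ^ 2 in
  quot x (a, b) <= 1 - 6 / 5 * x ^ 2 * s / (s + 2 * a * x + x ^ 2) ^ 2.
Proof.
intros Hz Hx.
destruct (cone_bounds a b x Hz Hx) as (Ha & Hs & Hd & Hax & Hx2).
rewrite quot_eq; set (s := a ^ 2 + b ^ 2) in *; cbv zeta.
assert (Hden : 0 < (s + 2 * a * x + x ^ 2) ^ 2) by (apply pow_lt; lra).
apply Rmult_le_reg_r with ((s + 2 * a * x + x ^ 2) ^ 2); [exact Hden|].
unfold Rdiv; rewrite Rmult_minus_distr_r, !Rmult_assoc, Rinv_l by lra.
assert (E : (s + 2 * a * x + x ^ 2) ^ 2 - s * (s + 4 * a * x + 4 * x ^ 2)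
  = x ^ 2 * (2 * (a ^ 2 - b ^ 2)) + x ^ 2 * x ^ 2 + 4 * (a * x) * x ^ 2)
  by (unfold s; ring).
assert (0 <= x ^ 2 * (2 * (a ^ 2 - b ^ 2) - 6 / 5 * s)) by (apply Rmult_le_pos; lra).
assert (0 < x ^ 2 * x ^ 2) by (apply Rmult_lt_0_compat; lra).
assert (0 < 4 * (a * x) * x ^ 2) by (apply Rmult_lt_0_compat; lra).
lra.
Qed.

Lemma quot_le1 (x : R) (z : C) : cone z -> 0 < x -> quot x z <= 1.
Proof.
destruct z as [a b]; intros Hz Hx.
pose proof (quot_defect x a b Hz Hx) as H; cbv zeta in H.
destruct (cone_bounds a b x Hz Hx) as (Ha & Hs & Hd & Hax & Hx2).
set (s := a ^ 2 + b ^ 2) in *.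
assert (0 <= 6 / 5 * x ^ 2 * s / (s + 2 * a * x + x ^ 2) ^ 2); [|lra].
apply Rmult_le_pos; [apply Rmult_le_pos; lra|].
apply Rlt_le, Rinv_0_lt_compat, pow_lt; lra.
Qed.

Lemma one_sub_le_exp (v : R) : 1 - v <= exp (- v).
Proof. pose proof (exp_ineq1_le (- v)); lra. Qed.

Lemma quot_le_exp (x : R) (z : C) : cone z -> 0 < x -> x <= Cmod z ->
  quot x z <= exp (- (3 / 40 * x ^ 2) * (1 / Cmod z ^ 2)).
Proof.
destruct z as [a b]; intros Hz Hx Hm.
pose proof (quot_defect x a b Hz Hx) as H; cbv zeta in H.
destruct (cone_bounds a b x Hz Hx) as (Ha & Hs & Hd & Hax & Hx2).
assert (Hxs : x ^ 2 <= a ^ 2 + b ^ 2).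
{ pose proof (Cmod2 (a, b)) as E; simpl fst in E; simpl snd in E.
  rewrite <- E; apply pow_incr; lra. }
rewrite Cmod2; simpl fst; simpl snd.
assert (Hax2 : 2 * a * x <= 2 * (a ^ 2 + b ^ 2)) by nra.
set (s := a ^ 2 + b ^ 2) in *.
apply Rle_trans with (1 := H).
eapply Rle_trans; [|rewrite Ropp_mult_distr_l_reverse; apply one_sub_le_exp].
apply Rplus_le_compat_l, Ropp_le_contravar.
assert (Hden : 0 < (s + 2 * a * x + x ^ 2) ^ 2) by (apply pow_lt; lra).
(* For x <= |z| the base of the denominator is at most s + 2s + s = 4s, and 6/5 divided by 16 is
   3/40. *)
replace (3 / 40 * x ^ 2 * (1 / s)) with (6 / 5 * x ^ 2 * s * / (4 * s) ^ 2)
  by (field; lra).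
apply Rmult_le_compat_l; [apply Rmult_le_pos; lra|].
apply Rinv_le_contravar; [exact Hden|].
apply pow_incr; lra.
Qed.

Lemma quot_ge (x : R) (z : C) : cone z -> 0 < x ->
  (/ (1 + x ^ 2 * (1 / Cmod z ^ 2))) ^ 2 <= quot x z.
Proof.
destruct z as [a b]; intros Hz Hx.
destruct (cone_bounds a b x Hz Hx) as (Ha & Hs & Hd & Hax & Hx2).
rewrite quot_eq, Cmod2; simpl fst; simpl snd.
set (s := a ^ 2 + b ^ 2) in *.
assert (Hden : 0 < (s + 2 * a * x + x ^ 2) ^ 2) by (apply pow_lt; lra).
apply (proj1 (Rle_div_r _ _ _ Hden)).
replace ((/ (1 + x ^ 2 * (1 / s))) ^ 2 * (s + 2 * a * x + x ^ 2) ^ 2)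
  with (s ^ 2 * (s + 2 * a * x + x ^ 2) ^ 2 / (s + x ^ 2) ^ 2)
  by (field; split; lra).
assert (Hden' : 0 < (s + x ^ 2) ^ 2) by (apply pow_lt; lra).
apply (proj2 (Rle_div_l _ _ _ Hden')).
assert (Hsx : a ^ 2 <= s) by (unfold s; nra).
replace (s * (s + 4 * a * x + 4 * x ^ 2) * (s + x ^ 2) ^ 2)
  with (s * ((s + 4 * a * x + 4 * x ^ 2) * (s + x ^ 2) ^ 2)) by ring.
replace (s ^ 2 * (s + 2 * a * x + x ^ 2) ^ 2)
  with (s * (s * (s + 2 * a * x + x ^ 2) ^ 2)) by ring.
apply Rmult_le_compat_l; [lra|].
set (p := a * x) in *. set (q := x ^ 2) in *.
(* After expansion the only negative term of the difference is - 4 s p^2, which 4 s^2 q absorbs by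
   this inequality. *)
assert (Hpq : p ^ 2 <= s * q).
{ unfold p; rewrite Rpow_mult_distr; fold q; apply Rmult_le_compat_r; lra. }
replace (s + 2 * a * x + q) with (s + 2 * p + q) by (unfold p; ring).
replace (s + 4 * a * x + 4 * q) with (s + 4 * p + 4 * q) by (unfold p; ring).
assert (0 < s * q) by (apply Rmult_lt_0_compat; lra).
assert (0 < p) by exact Hax.
assert (0 < s * (s * q)) by (apply Rmult_lt_0_compat; lra).
assert (0 < q * (s * q)) by (apply Rmult_lt_0_compat; lra).
assert (0 < p * (s * q)) by (apply Rmult_lt_0_compat; lra).
assert (0 < q * q) by (apply Rmult_lt_0_compat; lra).
assert (0 < p * (q * q)) by (apply Rmult_lt_0_compat; lra).
assert (0 < q * (q * q)) by (apply Rmult_lt_0_compat; lra).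
assert (s * p ^ 2 <= s * (s * q)) by (apply Rmult_le_compat_l; lra).
lra.
Qed.

(** The decay contributed by a fixed pole as x grows: [quot] is a squared modulus, so x^-2 here
    means 1/x for the modulus. *)
Lemma quot_le_inv (x : R) (z : C) : cone z -> 0 < x ->
  quot x z <= 4 * Cmod z ^ 2 / x ^ 2.
Proof.
destruct z as [a b]; intros Hz Hx.
destruct (cone_bounds a b x Hz Hx) as (Ha & Hs & Hd & Hax & Hx2).
rewrite quot_eq, Cmod2; simpl fst; simpl snd.
set (s := a ^ 2 + b ^ 2) in *.
assert (Hden : 0 < s + 2 * a * x + x ^ 2) by lra.
apply Rle_trans with (s * (4 * (s + 2 * a * x + x ^ 2)) / (s + 2 * a * x + x ^ 2) ^ 2).
- apply Rmult_le_compat_r; [apply Rlt_le, Rinv_0_lt_compat, pow_lt; lra|].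
  apply Rmult_le_compat_l; lra.
- replace (s * (4 * (s + 2 * a * x + x ^ 2)) / (s + 2 * a * x + x ^ 2) ^ 2)
    with (4 * s * / (s + 2 * a * x + x ^ 2)) by (field; lra).
  apply Rmult_le_compat_l; [lra|]. apply Rinv_le_contravar; lra.
Qed.

Lemma cone_neg_real (z : C) (u : R) :
  cone z -> u <= 0 -> 0 < Cmod (RtoC u - z).
Proof.
intros [Hz _] Hu; apply Cmod_gt_0; intros E.
apply (f_equal fst) in E; simpl in E; lra.
Qed.

Lemma lprod_quot (x : R) (l : list C) :
  0 < x -> (forall z, In z l -> cone z) ->
  let P u := lprod (fun w => Cmod (RtoC u - w)) l in
  lprod (quot x) l * P (- x) ^ 4 = (P 0 * P (- 2 * x)) ^ 2.
Proof.
intros Hx Hl; cbv zeta; induction l as [|a l IH].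
- simpl; ring.
- assert (Ha : 0 < Cmod (RtoC (- x) - a)).
  { apply cone_neg_real; [apply Hl; now left | lra]. }
  cbn [lprod fold_right]; fold (lprod (quot x) l).
  fold (lprod (fun w => Cmod (RtoC (- x) - w)) l)
    (lprod (fun w => Cmod (RtoC 0 - w)) l)
    (lprod (fun w => Cmod (RtoC (- 2 * x) - w)) l).
  transitivity ((Cmod (RtoC 0 - a) * Cmod (RtoC (- 2 * x) - a)) ^ 2
    * (lprod (quot x) l * lprod (fun w => Cmod (RtoC (- x) - w)) l ^ 4)).
  + unfold quot; field; lra.
  + rewrite IH by (intros z Hz; apply Hl; now right); ring.
Qed.

(** The values at 0, -2x and -x enter with exponents 2, 2 and -4, which sum to 0, so the constant
    [a] cancels and only poles and zeros remain. *)
Lemma factor_quot (F : C -> C) (a : C) (ts ws : list C) (x : R) :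
  0 < x -> (forall z, In z ts -> cone z) -> (forall z, In z ws -> cone z) ->
  (forall z, ~ In z ts -> (F z * rprod ts z)%C = (a * rprod ws z)%C) ->
  (Cmod (F (RtoC 0)) * Cmod (F (RtoC (- 2 * x)))) ^ 2 * lprod (quot x) ts
  = Cmod (F (RtoC (- x))) ^ 4 * lprod (quot x) ws.
Proof.
intros Hx Ht Hw HF.
pose proof (lprod_quot x ts Hx Ht) as HA; pose proof (lprod_quot x ws Hx Hw) as HB.
cbv zeta in HA, HB.
assert (HE : forall u, u <= 0 ->
  Cmod (F (RtoC u)) * lprod (fun w => Cmod (RtoC u - w)) ts
  = Cmod a * lprod (fun w => Cmod (RtoC u - w)) ws).
{ intros u Hu; rewrite <- !Cmod_rprod, <- !Cmod_mult; f_equal; apply HF.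
  intros Hi; destruct (Ht _ Hi) as [H _]; simpl in H; lra. }
pose proof (HE 0 ltac:(lra)) as H0; pose proof (HE (- x) ltac:(lra)) as H1.
pose proof (HE (- 2 * x) ltac:(lra)) as H2; clear HE.
assert (HP : 0 < lprod (fun w => Cmod (RtoC (- x) - w)) ts).
{ apply lprod_pos; intros z Hz; apply cone_neg_real; [auto | lra]. }
set (A1 := lprod (fun w => Cmod (RtoC (- x) - w)) ts) in *.
set (A0 := lprod (fun w => Cmod (RtoC 0 - w)) ts) in *.
set (A2 := lprod (fun w => Cmod (RtoC (- 2 * x) - w)) ts) in *.
set (B1 := lprod (fun w => Cmod (RtoC (- x) - w)) ws) in *.
set (B0 := lprod (fun w => Cmod (RtoC 0 - w)) ws) in *.
set (B2 := lprod (fun w => Cmod (RtoC (- 2 * x) - w)) ws) in *.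
set (f0 := Cmod (F (RtoC 0))) in *. set (f1 := Cmod (F (RtoC (- x)))) in *.
set (f2 := Cmod (F (RtoC (- 2 * x)))) in *.
apply Rmult_eq_reg_r with (A1 ^ 4); [|apply pow_nonzero; lra].
transitivity (((f0 * A0) * (f2 * A2)) ^ 2).
{ rewrite Rmult_assoc, HA; ring. }
rewrite H0, H2.
transitivity ((f1 * A1) ^ 4 * lprod (quot x) ws); [|ring].
rewrite H1.
transitivity (Cmod a ^ 4 * (B0 * B2) ^ 2); [ring|].
rewrite <- HB; ring.
Qed.

(** * Size on the negative axis and the resulting bounds on zeros *)

Lemma psum_neg_upper (L : list (R * C)) (x : R) :
  weights_pos L -> (forall p, In p L -> cone (snd p)) -> 0 <= x ->
  Cmod (psum L (RtoC (- x))) <= lsum (fun p => fst p / Cmod (snd p)) L.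
Proof.
intros Hc Ht Hx; induction L as [|[c t] L IH]; [simpl; rewrite Cmod_0; lra|].
cbn [psum lsum fold_right]; fold (psum L (RtoC (- x))).
fold (lsum (fun p => fst p / Cmod (snd p)) L).
eapply Rle_trans; [apply Cmod_triangle|].
apply Rplus_le_compat;
  [|apply IH; intros p Hp; [apply Hc | apply Ht]; now right].
pose proof (Hc _ (or_introl eq_refl)) as Hc0.
pose proof (Ht _ (or_introl eq_refl)) as Hct; simpl fst in *; simpl snd in *.
pose proof (cone_neg_real t (- x) Hct ltac:(lra)) as Hp.
pose proof (cone_neg_real t 0 Hct ltac:(lra)) as Hp0.
replace (RtoC 0 - t)%C with (- t)%C in Hp0 by ring; rewrite Cmod_opp in Hp0.
rewrite Cmod_div by (apply Cmod_gt_0; exact Hp).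
rewrite Cmod_R, Rabs_pos_eq by lra.
(* Since Re t > 0 and x >= 0, the distance from -x to t is at least |t|. *)
apply Rmult_le_compat_l; [lra|]; apply Rinv_le_contravar; [exact Hp0|].
apply Rsqr_incr_0_var; [|lra].
rewrite !Rsqr_pow2, !Cmod2; destruct t as [u v], Hct as [Hu _]; simpl in *; nra.
Qed.

(** On the negative axis every term has negative real part, so nothing cancels and one term bounds
    the whole sum from below. *)
Lemma psum_neg_lower (L : list (R * C)) (c0 : R) (t0 : C) (x : R) :
  weights_pos L -> (forall p, In p L -> cone (snd p)) -> 0 <= x ->
  In (c0, t0) L ->
  4 / 5 * c0 / (fst t0 + x) <= Cmod (psum L (RtoC (- x))).
Proof.
intros Hc Ht Hx Hi.
apply Rle_trans with (- fst (psum L (RtoC (- x)))).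
2:{ eapply Rle_trans; [|apply re_le_Cmod]. unfold Re.
    rewrite <- Rabs_Ropp; apply Rle_abs. }
assert (G : forall p, In p L -> 0 < 4 / 5 * fst p / (fst (snd p) + x)
  <= - fst (RtoC (fst p) / (RtoC (- x) - snd p))%C).
{ intros [c [u v]] Hp.
  pose proof (Hc _ Hp) as Hc0; pose proof (Ht _ Hp) as [Hu Hv]; simpl in *.
  assert (Hxu : 0 < u + x) by lra.
  (* The cone condition gives |x + t|^2 <= 5/4 (u + x)^2, whence the factor 4/5. *)
  assert (Hv2 : 0 <= v * v <= (u + x) * (u + x) / 4) by nra.
  assert (Hs : 0 < (u + x) * (u + x)) by (apply Rmult_lt_0_compat; lra).
  split.
  { apply Rdiv_lt_0_compat; lra. }
  match goal with |- _ <= ?B => replace B with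
    (c * ((u + x) / ((u + x) * (u + x) + v * v))) end.
  2:{ field; nra. }
  replace (4 / 5 * c / (u + x))
    with (c * ((u + x) / ((u + x) * (u + x) + (u + x) * (u + x) / 4)))
    by (field; lra).
  apply Rmult_le_compat_l; [lra|]; apply Rmult_le_compat_l; [lra|].
  apply Rinv_le_contravar; lra. }
clear Hc Ht; revert Hi.
enough (0 <= - fst (psum L (RtoC (- x))) /\ (In (c0, t0) L ->
  4 / 5 * c0 / (fst t0 + x) <= - fst (psum L (RtoC (- x))))) by tauto.
induction L as [|p L IH]; [simpl; split; [lra | easy]|].
destruct IH as [IH1 IH2]; [intros q Hq; apply G; now right|].
pose proof (G p (or_introl eq_refl)) as Gp.
cbn [psum fold_right]; fold (psum L (RtoC (- x))).
change (fst (?a + ?b)%C) with (fst a + fst b).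
split; [lra|].
intros [-> | Hi]; [simpl fst in Gp at 1; simpl snd in Gp at 1; cbn [fst snd] in *; lra|].
specialize (IH2 Hi); lra.
Qed.

Lemma exp_le_lprod_quot (x : R) (l : list C) :
  0 < x -> (forall z, In z l -> cone z) ->
  exp (- (2 * x ^ 2) * lsum (fun w => 1 / Cmod w ^ 2) l) <= lprod (quot x) l.
Proof.
intros Hx Hl; rewrite <- lprod_exp; apply lprod_le; intros z Hz.
split; [apply Rlt_le, exp_pos|].
eapply Rle_trans; [|apply quot_ge; auto].
set (v := x ^ 2 * (1 / Cmod z ^ 2)).
replace (- (2 * x ^ 2) * (1 / Cmod z ^ 2)) with (- v + - v) by (unfold v; ring).
rewrite exp_plus; simpl; rewrite Rmult_1_r.
assert (Hv : 0 <= v).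
{ unfold v; apply Rmult_le_pos; [apply pow2_ge_0|].
  assert (0 < Cmod z ^ 2).
  { rewrite Cmod2; destruct (Hl z Hz) as [H _].
    pose proof (pow2_ge_0 (snd z)); nra. }
  apply Rlt_le, Rdiv_lt_0_compat; lra. }
assert (H : exp (- v) <= / (1 + v)).
{ rewrite exp_Ropp; apply Rinv_le_contravar; [lra | apply exp_ineq1_le]. }
pose proof (exp_pos (- v)); apply Rmult_le_compat; lra.
Qed.

Lemma lprod_quot_le_exp (x : R) (l : list C) :
  0 < x -> (forall z, In z l -> cone z /\ x <= Cmod z) ->
  lprod (quot x) l
  <= exp (- (3 / 40 * x ^ 2) * lsum (fun w => 1 / Cmod w ^ 2) l).
Proof.
intros Hx Hl; rewrite <- lprod_exp; apply lprod_le; intros z Hz.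
destruct (Hl z Hz); split; [now apply Rlt_le, quot_pos | now apply quot_le_exp].
Qed.

(** Two opposing estimates for [S]: a few chosen poles force it to be large, while evaluation at an
    x below all moduli of zeros forces it to be small. [L] enters the constants only through [m] and
    [M], so uniform [m] and [M] allow parameters to be fixed before the length of the partial
    sum. *)
Lemma zeros_bounds (L : list (R * C)) (m M : R) :
  weights_pos L -> L <> [] -> (forall p, In p L -> cone (snd p)) ->
  0 < m ->
  (forall x, 0 <= x -> m / (1 + x) <= Cmod (psum L (RtoC (- x))) <= M) ->
  exists ws : list C,
    let S := lsum (fun w => 1 / Cmod w ^ 2) ws in
    (forall w, In w ws -> ~ In w (map snd L) /\ psum L w = RtoC 0) /\
    (forall (x : R) (l : list C), 0 < x -> NoDup l -> incl l (map snd L) ->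
      exp (- (2 * x ^ 2) * S)
      <= (M / m * (1 + x)) ^ 4 * lprod (quot x) l) /\
    (forall x : R, 0 < x -> (forall w, In w ws -> x <= Cmod w) ->
      (m / M) ^ 4 / (1 + 2 * x) ^ 2 * lprod (quot x) (map snd L)
      <= exp (- (3 / 40 * x ^ 2) * S)).
Proof.
intros Hc Hn Ht Hm HM.
destruct (psum_factor L Hc) as (a & ts & ws & Hd & Hi & Hw & Hf).
exists ws; cbv zeta.
assert (Hct : forall z, In z (map snd L) -> cone z).
{ intros z Hz; apply in_map_iff in Hz as (p & <- & Hp); auto. }
assert (Hct' : forall z, In z ts -> cone z) by (intros z Hz; now apply Hct, Hi).
assert (Hcw : forall z, In z ws -> cone z).
{ intros z Hz; apply psum_zero_cone with L; auto; now apply Hw. }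
assert (HM0 : 0 < M).
{ pose proof (HM 0 ltac:(lra)) as H; unfold Rdiv in H.
  rewrite Rplus_0_r, Rinv_1, Rmult_1_r in H; lra. }
split; [intros w H; rewrite <- Hi; now apply Hw|].
(* The bounds on |f(0)|, |f(-x)| and |f(-2x)| turn [factor_quot] into a comparison, in both
   directions, of the products over zeros and over poles. *)
assert (Key : forall x, 0 < x ->
  (m ^ 2 / (1 + 2 * x)) ^ 2 * lprod (quot x) ts <= M ^ 4 * lprod (quot x) ws /\
  (m / (1 + x)) ^ 4 * lprod (quot x) ws <= M ^ 4 * lprod (quot x) ts).
{ intros x Hx.
  pose proof (factor_quot _ a ts ws x Hx Hct' Hcw Hf) as E.
  assert (Hpt : 0 < lprod (quot x) ts)
    by (apply lprod_pos; intros; apply quot_pos; auto).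
  assert (Hpw : 0 < lprod (quot x) ws)
    by (apply lprod_pos; intros; apply quot_pos; auto).
  pose proof (HM 0 ltac:(lra)) as H0; pose proof (HM x ltac:(lra)) as H1.
  pose proof (HM (2 * x) ltac:(lra)) as H2.
  rewrite Ropp_0 in H0; replace (- (2 * x)) with (- 2 * x) in H2 by ring.
  replace (m / (1 + 0)) with m in H0 by (field).
  assert (0 < m / (1 + x)) by (apply Rdiv_lt_0_compat; lra).
  assert (0 < m / (1 + 2 * x)) by (apply Rdiv_lt_0_compat; lra).
  set (f0 := Cmod (psum L (RtoC 0))) in *.
  set (f1 := Cmod (psum L (RtoC (- x)))) in *.
  set (f2 := Cmod (psum L (RtoC (- 2 * x)))) in *.
  split.
  - apply Rle_trans with ((f0 * f2) ^ 2 * lprod (quot x) ts).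
    + apply Rmult_le_compat_r; [lra|]; apply pow_incr.
      replace (m ^ 2 / (1 + 2 * x)) with (m * (m / (1 + 2 * x))) by (field; lra).
      split; [apply Rmult_le_pos | apply Rmult_le_compat]; lra.
    + rewrite E; apply Rmult_le_compat_r; [lra|]; apply pow_incr; lra.
  - apply Rle_trans with (f1 ^ 4 * lprod (quot x) ws).
    + apply Rmult_le_compat_r; [lra|]; apply pow_incr; lra.
    + rewrite <- E; apply Rmult_le_compat_r; [lra|].
      replace (M ^ 4) with ((M * M) ^ 2) by ring; apply pow_incr.
      split; [apply Rmult_le_pos | apply Rmult_le_compat]; lra. }
split.
- intros x l Hx Hdl Hil.
  eapply Rle_trans; [apply exp_le_lprod_quot; auto|].
  destruct (Key x Hx) as [_ K].
  apply Rle_trans with ((M / m * (1 + x)) ^ 4 * lprod (quot x) ts).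
  + assert (Hp : 0 < (m / (1 + x)) ^ 4)
      by (apply pow_lt, Rdiv_lt_0_compat; lra).
    apply Rmult_le_reg_l with (1 := Hp); eapply Rle_trans; [exact K|].
    apply Req_le; field; lra.
  + apply Rmult_le_compat_l.
    { apply pow_le, Rmult_le_pos; [apply Rlt_le, Rdiv_lt_0_compat; lra | lra]. }
    apply lprod_incl; [exact Hdl | intros z Hz; now apply Hi, Hil|].
    intros z Hz; split; [apply quot_pos | apply quot_le1]; auto.
- intros x Hx Hxw.
  eapply Rle_trans; [|apply lprod_quot_le_exp; [exact Hx | auto]].
  destruct (Key x Hx) as [K _].
  apply Rle_trans with ((m / M) ^ 4 / (1 + 2 * x) ^ 2 * lprod (quot x) ts).
  + apply Rmult_le_compat_l.
    { apply Rmult_le_pos; [apply pow_le, Rlt_le, Rdiv_lt_0_compat; lra|].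
      apply Rlt_le, Rinv_0_lt_compat, pow_lt; lra. }
    (* The list [map snd L] may repeat poles; removing the repetitions only enlarges the product. *)
    apply lprod_incl; [exact Hd | intros z Hz; now apply Hi|].
    intros z Hz; split; [apply quot_pos | apply quot_le1]; auto.
  + assert (Hp : 0 < M ^ 4) by (apply pow_lt; lra).
    apply Rmult_le_reg_l with (1 := Hp); eapply Rle_trans; [|exact K].
    apply Req_le; field; lra.
Qed.

(** * Escape of the zeros of the partial sums *)

Lemma arg_cone (z : C) : z <> RtoC 0 -> Rabs (Carg z) < PI / 8 -> cone z.
Proof.
intros Hz Ha.
pose proof (proj1 (Cmod_gt_0 z) Hz) as Hr.
rewrite (Carg_polar z Hz); set (r := Cmod z) in *; set (a := Carg z) in *.
apply Rabs_def2 in Ha; pose proof PI_RGT_0.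
assert (Hc : 0 < cos a) by (apply cos_gt_0; lra).
(* [tan (PI / 8) <= 1 / 2], from [sin (2 b) <= cos (2 b)] for [0 <= 2 b <= PI / 4]. *)
assert (G : forall b, 0 <= b < PI / 8 -> 2 * sin b <= cos b).
{ intros b Hb.
  assert (Hcb : 0 < cos b) by (apply cos_gt_0; lra).
  assert (Hsb : 0 <= sin b) by (apply sin_ge_0; lra).
  assert (H2 : sin (2 * b) <= cos (2 * b)).
  { apply Rle_trans with (sin (PI / 4)); [apply sin_incr_1; lra|].
    rewrite sin_PI4, <- cos_PI4; apply cos_decr_1; lra. }
  rewrite sin_2a, cos_2a in H2; nra. }
unfold cone; simpl; split; [now apply Rmult_lt_0_compat|].
assert (Hs : - cos a <= 2 * sin a <= cos a).
{ destruct (Rle_dec 0 a) as [H0 | H0].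
  - assert (0 <= sin a) by (apply sin_ge_0; lra).
    pose proof (G a ltac:(lra)); lra.
  - pose proof (G (- a) ltac:(lra)) as H1; rewrite sin_neg, cos_neg in H1.
    assert (0 <= sin (- a)) as H2 by (apply sin_ge_0; lra).
    rewrite sin_neg in H2; lra. }
nra.
Qed.

(** * Finite sums, series and partial sums of f *)

Fixpoint csum (d : nat -> C) (N : nat) : C :=
  match N with O => RtoC 0 | S k => (csum d k + d k)%C end.

Fixpoint rsum (a : nat -> R) (N : nat) : R :=
  match N with O => 0 | S k => rsum a k + a k end.

Lemma csum_dist (d e : nat -> C) (a : nat -> R) (K : R) (N : nat) :
  (forall n, Cmod (d n - e n) <= K * a n) ->
  Cmod (csum d N - csum e N) <= K * rsum a N.
Proof.
intros H; induction N as [|N IH]; simpl.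
- replace (RtoC 0 - RtoC 0)%C with (RtoC 0) by ring; rewrite Cmod_0; lra.
- replace (csum d N + d N - (csum e N + e N))%C
    with (csum d N - csum e N + (d N - e N))%C by ring.
  eapply Rle_trans; [apply Cmod_triangle|]; specialize (H N); lra.
Qed.

(** The index shifts because [sum_n] includes the term of index N, whereas [csum] stops just before
    it and starts from an empty sum. *)
Lemma csum_sum_n (d : nat -> C) (N : nat) :
  csum d (S N) = sum_n (G := C_NormedModule) d N.
Proof.
induction N as [|N IH].
- rewrite sum_O; simpl; ring.
- rewrite sum_Sn, <- IH; reflexivity.
Qed.

Lemma rsum_sum_n (a : nat -> R) (N : nat) : rsum a (S N) = sum_n a N.
Proof.
induction N as [|N IH].
- rewrite sum_O; simpl; ring.
- rewrite sum_Sn, <- IH; reflexivity.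
Qed.

Lemma rsum_mono (a : nat -> R) (N K : nat) :
  (forall n, 0 <= a n) -> rsum a N <= rsum a (N + K).
Proof.
intros H; induction K as [|K IH]; [rewrite Nat.add_0_r; lra|].
rewrite Nat.add_succ_r; simpl; specialize (H (N + K)%nat); lra.
Qed.

Lemma rsum_le_series (a : nat -> R) (l : R) (N : nat) :
  (forall n, 0 <= a n) -> is_series a l -> rsum a N <= l.
Proof.
intros H Hs.
apply Rle_trans with (rsum a (N + 1)); [now apply rsum_mono|].
rewrite Nat.add_1_r, rsum_sum_n.
apply (is_lim_seq_incr_compare (sum_n a) l); [exact Hs|].
intros n; rewrite sum_Sn; unfold plus; simpl; specialize (H (S n)); lra.
Qed.

Lemma rsum_tail (a : nat -> R) (eps : R) :
  (forall n, 0 <= a n) -> ex_series a -> 0 < eps ->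
  exists M, forall K, rsum a (M + K) - rsum a M <= eps.
Proof.
intros H [l Hs] He.
destruct (proj2 (is_lim_seq_spec (sum_n a) l) Hs (mkposreal _ He)) as [M HM].
exists (S M); intros K; simpl in HM.
pose proof (rsum_le_series a l (S M + K) H Hs).
specialize (HM M (le_n M)); rewrite <- rsum_sum_n in HM.
apply Rabs_def2 in HM; lra.
Qed.

(** The finitely many values before the threshold are absorbed one at a time into the minimum, by
    induction on the threshold. *)
Lemma positive_lower_bound (g : nat -> R) (e : R) :
  (forall n, 0 < g n) -> 0 < e -> (exists M, forall n, (M <= n)%nat -> e <= g n) ->
  exists eta, 0 < eta /\ forall n, eta <= g n.
Proof.
intros Hg He [M HM]; revert e He HM; induction M as [|M IH]; intros e He HM.
- exists e; split; [exact He | intros n; apply HM; lia].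
- apply IH with (Rmin e (g M)); [now apply Rmin_glb_lt|].
  intros n Hn; destruct (Nat.eq_dec n M) as [-> | Hne]; [apply Rmin_r|].
  apply Rle_trans with e; [apply Rmin_l | apply HM; lia].
Qed.

Definition partial (c : nat -> R) (t : nat -> C) (N : nat) : list (R * C) :=
  map (fun n => (c n, t n)) (seq 0 N).

Lemma in_partial (c : nat -> R) (t : nat -> C) (N n : nat) :
  (n < N)%nat -> In (c n, t n) (partial c t N).
Proof.
intros H; apply in_map_iff; exists n; split; [easy | apply in_seq; lia].
Qed.

Lemma partial_inv (c : nat -> R) (t : nat -> C) (N : nat) (p : R * C) :
  In p (partial c t N) -> exists n, p = (c n, t n).
Proof. intros H; apply in_map_iff in H as (n & <- & _); now exists n. Qed.

Lemma snd_partial (c : nat -> R) (t : nat -> C) (N : nat) :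
  map snd (partial c t N) = map t (seq 0 N).
Proof. unfold partial; now rewrite map_map. Qed.

Lemma psum_partial (c : nat -> R) (t : nat -> C) (N : nat) (z : C) :
  psum (partial c t N) z = csum (fun n => RtoC (c n) / (z - t n))%C N.
Proof.
induction N as [|N IH]; [reflexivity|].
unfold partial; rewrite seq_S, map_app, psum_app; fold (partial c t N).
rewrite IH; simpl; ring.
Qed.

Lemma lsum_partial (c : nat -> R) (t : nat -> C) (N : nat) :
  lsum (fun p => fst p / Cmod (snd p)) (partial c t N)
  = rsum (fun n => c n / Cmod (t n)) N.
Proof.
assert (G : forall l l' : list (R * C), lsum (fun p => fst p / Cmod (snd p)) (l ++ l')
  = lsum (fun p => fst p / Cmod (snd p)) l + lsum (fun p => fst p / Cmod (snd p)) l').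
{ induction l as [|a l IH]; intros l'; simpl; [|rewrite IH]; ring. }
induction N as [|N IH]; [reflexivity|].
unfold partial; rewrite seq_S, map_app, G; fold (partial c t N).
rewrite IH; simpl; ring.
Qed.

Lemma im_le_Cmod (z : C) : Rabs (Im z) <= Cmod z.
Proof.
eapply Rle_trans; [apply Rmax_r | apply Rmax_Cmod].
Qed.

Lemma Cseries_dominated (d : nat -> C) (a : nat -> R) :
  (forall n, Cmod (d n) <= a n) -> ex_series a ->
  exists l : C, is_series (V := C_NormedModule) d l.
Proof.
intros H Ha.
assert (G : forall pr : C -> R, (forall z, Rabs (pr z) <= Cmod z) ->
  exists l, is_series (fun n => pr (d n)) l).
{ intros pr Hpr; apply (ex_series_le (V := R_CompleteNormedModule) _ a); [|exact Ha].
  intros n; eapply Rle_trans; [apply Hpr | apply H]. }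
destruct (G fst) as [l1 H1]; [apply re_le_Cmod|].
destruct (G snd) as [l2 H2]; [apply im_le_Cmod|].
exists (l1, l2); apply filterlim_locally; intros eps.
pose proof (proj1 (filterlim_locally (sum_n (fun n => fst (d n))) l1) H1 eps) as E1.
pose proof (proj1 (filterlim_locally (sum_n (fun n => snd (d n))) l2) H2 eps) as E2.
generalize (filter_and _ _ E1 E2); apply filter_imp; intros N [F1 F2].
assert (E : forall N, sum_n (G := C_NormedModule) d N
  = (sum_n (fun n => fst (d n)) N, sum_n (fun n => snd (d n)) N)).
{ clear; induction N as [|N IH]; [rewrite !sum_O; apply surjective_pairing|].
  rewrite !sum_Sn, IH; reflexivity. }
rewrite E; split; assumption.
Qed.

Lemma Cmod_sub_neq (z w : C) : z <> w -> 0 < Cmod (z - w).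
Proof.
intros H; apply Cmod_gt_0; intros E; apply H.
replace z with (z - w + w)%C by ring; rewrite E; ring.
Qed.

Lemma Cmod_sub_lower (a b : C) : Cmod a - Cmod b <= Cmod (a - b).
Proof.
pose proof (Cmod_triangle (a - b) b) as H.
replace (a - b + b)%C with a in H by ring; lra.
Qed.

Lemma Cmod_le_add (z : C) : Cmod z <= Rabs (fst z) + Rabs (snd z).
Proof.
pose proof (Rabs_pos (fst z)). pose proof (Rabs_pos (snd z)).
apply Rsqr_incr_0_var; [|lra].
rewrite !Rsqr_pow2, Cmod2, <- (pow2_abs (fst z)), <- (pow2_abs (snd z)); nra.
Qed.

(** * Local absence of zeros, uniformly in the partial sum *)

Section Escape.
Variables (t : nat -> C) (c : nat -> R) (T : R).
Hypothesis ht0 : forall n : nat, t n <> RtoC 0.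
Hypothesis htlim : is_lim_seq (fun n : nat => Cmod (t n)) p_infty.
Hypothesis hc : forall n : nat, 0 < c n.
Hypothesis hsum1 : is_series (fun n : nat => c n / Cmod (t n)) T.

Lemma modulus_pos (n : nat) : 0 < Cmod (t n).
Proof. now apply Cmod_gt_0. Qed.

Lemma modulus_large (B : R) : exists M, forall n, (M <= n)%nat -> B < Cmod (t n).
Proof. exact (proj2 (is_lim_seq_spec _ p_infty) htlim B). Qed.

Lemma ratio_pos (n : nat) : 0 < c n / Cmod (t n).
Proof. apply Rdiv_lt_0_compat; [apply hc | apply modulus_pos]. Qed.

Lemma ratio_rsum (N : nat) : rsum (fun n => c n / Cmod (t n)) N <= T.
Proof. apply rsum_le_series; [intros n; apply Rlt_le, ratio_pos | exact hsum1]. Qed.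

Lemma modulus_lower : exists mu, 0 < mu /\ forall n, mu <= Cmod (t n).
Proof.
apply positive_lower_bound with 1; [apply modulus_pos | lra|].
destruct (modulus_large 1) as [M HM]; exists M; intros n Hn.
specialize (HM n Hn); lra.
Qed.

(** As |t_n| tends to infinity, |z - t_n| / |t_n| is eventually at least 1/2, and the remaining
    indices are finite in number. The term c_n / (z - t_n) is thereby dominated by a multiple of c_n
    / |t_n|. *)
Lemma pole_separation (z : C) :
  exists eta, 0 < eta /\ forall n, t n <> z -> eta * Cmod (t n) <= Cmod (z - t n).
Proof.
destruct (positive_lower_bound (fun n =>
  (* The value 1 is a harmless positive default at indices whose pole is [z] itself. *)
  if excluded_middle_informative (t n = z) then 1
  else Cmod (z - t n) / Cmod (t n)) (1 / 2)) as (eta & He & Hn).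
- intros n; destruct (excluded_middle_informative (t n = z)) as [E | E]; [lra|].
  apply Rdiv_lt_0_compat; [apply Cmod_sub_neq; congruence | apply modulus_pos].
- lra.
- destruct (modulus_large (2 * Cmod z)) as [M HM]; exists M; intros n Hn.
  destruct (excluded_middle_informative (t n = z)) as [E | E]; [lra|].
  apply (proj1 (Rle_div_r _ _ _ (modulus_pos n))).
  specialize (HM n Hn); pose proof (Cmod_sub_lower (t n) z) as H.
  replace (t n - z)%C with (- (z - t n))%C in H by ring; rewrite Cmod_opp in H; lra.
- exists eta; split; [exact He|]; intros n E.
  specialize (Hn n); simpl in Hn.
  destruct (excluded_middle_informative (t n = z)) as [E' | _]; [easy|].
  now apply (proj2 (Rle_div_r _ _ _ (modulus_pos n))).
Qed.

Lemma pole_series_cvg (z : C) : (forall n, z <> t n) ->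
  exists w : C, is_series (V := C_NormedModule) (fun n => (RtoC (c n) / (z - t n))%C) w.
Proof.
intros Hz; destruct (pole_separation z) as (eta & He & Hs).
apply Cseries_dominated with (fun n => / eta * (c n / Cmod (t n))).
- intros n; specialize (Hs n (not_eq_sym (Hz n))).
  pose proof (modulus_pos n) as Ht; pose proof (hc n).
  assert (0 < eta * Cmod (t n)) by now apply Rmult_lt_0_compat.
  rewrite Cmod_div by (apply Cmod_gt_0; lra).
  rewrite Cmod_R, Rabs_pos_eq by lra.
  replace (/ eta * (c n / Cmod (t n))) with (c n * / (eta * Cmod (t n)))
    by (field; lra).
  apply Rmult_le_compat_l; [lra | now apply Rinv_le_contravar].
- apply (ex_series_scal (V := R_NormedModule)); now exists T.
Qed.

(** Moving the point by at most half of [eta * mu], where [mu] bounds all |t_n| from below, costs at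
    most half of the separation at [z0]. *)
Lemma near_pole_separation (z0 : C) : exists r k, 0 < r /\ 0 < k /\
  forall z n, Cmod (z - z0) < r -> t n <> z0 ->
    k * Cmod (t n) <= Cmod (z - t n) /\ k <= Cmod (z0 - t n).
Proof.
destruct (pole_separation z0) as (eta & He & Hs).
destruct modulus_lower as (mu & Hmu & Ht).
assert (0 < eta * mu) by now apply Rmult_lt_0_compat.
exists (eta * mu / 2), (Rmin (eta / 2) (eta * mu)); split; [lra|]; split.
{ apply Rmin_glb_lt; lra. }
intros z n Hz Hn; specialize (Hs n Hn); specialize (Ht n).
assert (eta * mu <= eta * Cmod (t n)) by (apply Rmult_le_compat_l; lra).
split; [|eapply Rle_trans; [apply Rmin_r | lra]].
apply Rle_trans with (eta / 2 * Cmod (t n)).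
{ apply Rmult_le_compat_r; [lra | apply Rmin_l]. }
pose proof (Cmod_sub_lower (z0 - t n) (z0 - z)) as H1.
replace (z0 - t n - (z0 - z))%C with (z - t n)%C in H1 by ring.
replace (z0 - z)%C with (- (z - z0))%C in H1 by ring; rewrite Cmod_opp in H1; lra.
Qed.

(** Terms with pole [t k] add up to modulus at least c_k / |z - t_k|, while all the others together
    stay below T / K near [t k]. *)
Lemma no_zero_near_pole (k : nat) : exists r, 0 < r /\
  forall N z, (k < N)%nat -> Cmod (z - t k) < r ->
    ~ In z (map t (seq 0 N)) -> psum (partial c t N) z <> RtoC 0.
Proof.
destruct (near_pole_separation (t k)) as (r & K & Hr & HK & Hs).
assert (HT : 0 <= T).
{ apply Rle_trans with (2 := ratio_rsum 0); simpl; lra. }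
assert (HKT : 0 < / K * T + 1).
{ assert (0 <= / K * T) by (apply Rmult_le_pos; [apply Rlt_le, Rinv_0_lt_compat|]; lra).
  lra. }
(* Within this radius c_k / |z - t_k| exceeds T / K + 1, hence the contribution of the other
   terms. *)
exists (Rmin r (c k / (/ K * T + 1))); split.
{ apply Rmin_glb_lt; [exact Hr | apply Rdiv_lt_0_compat; auto]. }
intros N z HN Hz Hi H0.
assert (Hzk : 0 < Cmod (z - t k)).
{ apply Cmod_sub_neq; intros ->; apply Hi, in_map, in_seq; lia. }
(* Selects the weights of every index that shares the pole [t k]. *)
set (a := fun n => if excluded_middle_informative (t n = t k) then c n else 0).
assert (Ha : c k <= rsum a N).
{ assert (Ha0 : forall n, 0 <= a n).
  { intros n; unfold a.
    destruct (excluded_middle_informative (t n = t k)); [apply Rlt_le, hc | lra]. }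
  replace N with (S k + (N - S k))%nat by lia.
  eapply Rle_trans; [|apply rsum_mono; exact Ha0].
  simpl; pose proof (rsum_mono a 0 k Ha0) as H; simpl in H.
  assert (a k = c k); [|lra].
  unfold a; destruct (excluded_middle_informative (t k = t k)); [easy | congruence]. }
assert (Hcs : csum (fun n => RtoC (a n) / (z - t k))%C N
  = (RtoC (rsum a N) / (z - t k))%C).
{ clear; induction N as [|N IH]; simpl; [|rewrite IH, RtoC_plus]; unfold Cdiv; ring. }
pose proof (csum_dist (fun n => RtoC (c n) / (z - t n))%C
  (fun n => RtoC (a n) / (z - t k))%C (fun n => c n / Cmod (t n)) (/ K) N) as HD.
rewrite <- psum_partial, H0, Hcs in HD.
replace (RtoC 0 - RtoC (rsum a N) / (z - t k))%C
  with (- (RtoC (rsum a N) / (z - t k)))%C in HD by ring.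
rewrite Cmod_opp, Cmod_div in HD by (apply Cmod_gt_0; exact Hzk).
pose proof (hc k) as Hck.
rewrite Cmod_R, Rabs_pos_eq in HD by lra.
assert (HD' : c k / Cmod (z - t k) <= / K * T).
{ apply Rle_trans with (rsum a N / Cmod (z - t k)).
  { apply Rmult_le_compat_r; [apply Rlt_le, Rinv_0_lt_compat|]; lra. }
  eapply Rle_trans; [apply HD|].
  - intros n; unfold a; pose proof (ratio_pos n).
    destruct (excluded_middle_informative (t n = t k)) as [E | E].
    + rewrite E.
      replace (RtoC (c n) / (z - t k) - RtoC (c n) / (z - t k))%C
        with (RtoC 0) by ring.
      rewrite Cmod_0; apply Rmult_le_pos;
        [apply Rlt_le, Rinv_0_lt_compat; lra | rewrite <- E; lra].
    + replace (RtoC (c n) / (z - t n) - RtoC 0 / (z - t k))%C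
        with (RtoC (c n) / (z - t n))%C by (unfold Cdiv; ring).
      destruct (Hs z n) as [H1 _];
        [eapply Rlt_le_trans; [exact Hz | apply Rmin_l] | exact E|].
      pose proof (modulus_pos n) as Ht; pose proof (hc n).
      assert (0 < K * Cmod (t n)) by now apply Rmult_lt_0_compat.
      rewrite Cmod_div by (apply Cmod_gt_0; lra).
      rewrite Cmod_R, Rabs_pos_eq by lra.
      replace (/ K * (c n / Cmod (t n))) with (c n * / (K * Cmod (t n)))
        by (field; lra).
      apply Rmult_le_compat_l; [lra | now apply Rinv_le_contravar].
  - apply Rmult_le_compat_l; [apply Rlt_le, Rinv_0_lt_compat; lra | apply ratio_rsum]. }
assert (Hz2 : Cmod (z - t k) < c k / (/ K * T + 1))
  by (eapply Rlt_le_trans; [exact Hz | apply Rmin_r]).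
apply (proj2 (Rlt_div_r _ _ _ HKT)) in Hz2.
apply (proj1 (Rle_div_l _ _ _ Hzk)) in HD'.
lra.
Qed.

(** The series converges at [z0] to some w <> 0, so late partial sums have modulus at least |w| / 2
    there; near [z0] their values differ from those at [z0] by at most T / K^2 times the distance,
    uniformly in N. *)
Lemma no_zero_near_regular (z0 : C) :
  (forall n, z0 <> t n) ->
  ~ is_series (V := C_NormedModule) (fun n => (RtoC (c n) / (z0 - t n))%C) (RtoC 0) ->
  exists r N0, 0 < r /\ forall N z, (N0 <= N)%nat -> Cmod (z - z0) < r ->
    psum (partial c t N) z <> RtoC 0.
Proof.
intros Hz0 Hns.
destruct (pole_series_cvg z0 Hz0) as [w Hw].
assert (Hw0 : 0 < Cmod w).
{ apply Cmod_gt_0; intros ->; now apply Hns. }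
assert (Hev : exists N0, forall N, (N0 <= N)%nat ->
  Cmod w / 2 <= Cmod (psum (partial c t N) z0)).
(* Balls in [C] control each coordinate separately, so two errors of |w| / 4 leave at least |w| /
   2. *)
{ assert (He : 0 < Cmod w / 4) by lra.
  pose proof (proj1 (filterlim_locally _ w) Hw (mkposreal _ He)) as [N0 HN].
  exists (S N0); intros N HNN; destruct N as [|N]; [lia|].
  specialize (HN N ltac:(lia)).
  rewrite psum_partial, csum_sum_n.
  assert (G : forall s : C, Rabs (fst s - fst w) < Cmod w / 4 ->
    Rabs (snd s - snd w) < Cmod w / 4 -> Cmod w / 2 <= Cmod s).
  { intros s B1 B2.
    pose proof (Cmod_sub_lower w (w - s)) as H.
    replace (w - (w - s))%C with s in H by ring.
    pose proof (Cmod_le_add (w - s)) as H'.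
    change (fst (w - s)%C) with (fst w - fst s) in H'.
    change (snd (w - s)%C) with (snd w - snd s) in H'.
    rewrite (Rabs_minus_sym (fst w)), (Rabs_minus_sym (snd w)) in H'; lra. }
  destruct HN as [B1 B2]; apply G; [exact B1 | exact B2]. }
destruct Hev as [N0 HN0].
destruct (near_pole_separation z0) as (r & K & Hr & HK & Hs).
assert (HT : 0 <= T).
{ apply Rle_trans with (2 := ratio_rsum 0); simpl; lra. }
set (Q := / (K * K) * T + 1).
assert (HKK : 0 < / (K * K)) by (apply Rinv_0_lt_compat, Rmult_lt_0_compat; lra).
assert (HQ : 0 < Q).
{ assert (0 <= / (K * K) * T) by (apply Rmult_le_pos; lra). unfold Q; lra. }
exists (Rmin r (Cmod w / 2 / Q)), N0; split.
{ apply Rmin_glb_lt; [exact Hr | apply Rdiv_lt_0_compat; lra]. }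
intros N z HN Hz H0.
assert (Hzr : Cmod (z - z0) < r) by (eapply Rlt_le_trans; [exact Hz | apply Rmin_l]).
assert (Hzq : Cmod (z - z0) < Cmod w / 2 / Q)
  by (eapply Rlt_le_trans; [exact Hz | apply Rmin_r]).
apply (proj2 (Rlt_div_r _ _ _ HQ)) in Hzq.
pose proof (Cmod_ge_0 (z - z0)) as Hz1.
pose proof (csum_dist (fun n => RtoC (c n) / (z0 - t n))%C
  (fun n => RtoC (c n) / (z - t n))%C (fun n => c n / Cmod (t n))
  (Cmod (z - z0) * / (K * K)) N) as HD.
rewrite <- !psum_partial, H0 in HD.
replace (psum (partial c t N) z0 - RtoC 0)%C
  with (psum (partial c t N) z0) in HD by ring.
specialize (HN0 N HN).
enough (Cmod (psum (partial c t N) z0) <= Cmod (z - z0) * (/ (K * K) * T)).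
{ unfold Q in Hzq; lra. }
eapply Rle_trans; [apply HD|].
- intros n.
  assert (Hne : t n <> z0) by (intros E; now apply (Hz0 n)).
  destruct (Hs z n Hzr Hne) as [H1 H2].
  pose proof (modulus_pos n) as Ht; pose proof (hc n) as Hcn.
  assert (H3 : 0 < K * Cmod (t n)) by now apply Rmult_lt_0_compat.
  assert (Hn1 : (z - t n)%C <> RtoC 0) by (apply Cmod_gt_0; lra).
  assert (Hn2 : (z0 - t n)%C <> RtoC 0) by (apply Cmod_gt_0; lra).
  replace (RtoC (c n) / (z0 - t n) - RtoC (c n) / (z - t n))%C
    with ((z - z0) * (RtoC (c n) / ((z0 - t n) * (z - t n))))%C
    by (field; split; assumption).
  rewrite Cmod_mult, Cmod_div by now apply Cmult_neq_0.
  rewrite Cmod_mult, Cmod_R, Rabs_pos_eq, Rmult_assoc by lra.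
  apply Rmult_le_compat_l; [exact Hz1|].
  replace (/ (K * K) * (c n / Cmod (t n))) with (c n * / (K * (K * Cmod (t n))))
    by (field; lra).
  apply Rmult_le_compat_l; [lra|]; apply Rinv_le_contravar.
  + now apply Rmult_lt_0_compat.
  + apply Rmult_le_compat; lra.
- rewrite Rmult_assoc; apply Rmult_le_compat_l; [exact Hz1|].
  apply Rmult_le_compat_l; [lra | apply ratio_rsum].
Qed.

(** Each point of the square [-B, B]^2 has a neighbourhood and an index past which no partial sum
    vanishes there; compactness makes the index uniform. *)
Lemma zeros_escape :
  (forall z, ~ is_pole_series c t z (RtoC 0)) ->
  forall B : R, exists N0, forall N w, (N0 <= N)%nat ->
    ~ In w (map t (seq 0 N)) -> psum (partial c t N) w = RtoC 0 -> B <= Cmod w.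
Proof.
intros Hno B.
(* [d] encodes both a radius and, through [/ d <= INR N], an index threshold, so that the uniform [d] given by compactness controls the two at once. *)
assert (Hloc : forall u v : R, exists d : posreal, forall N z,
  / d <= INR N -> Rabs (fst z - u) < d -> Rabs (snd z - v) < d ->
  ~ In z (map t (seq 0 N)) -> psum (partial c t N) z <> RtoC 0).
{ intros u v.
  assert (H : exists r N0, 0 < r /\ forall N z, (N0 <= N)%nat ->
    Cmod (z - (u, v)) < r -> ~ In z (map t (seq 0 N)) ->
    psum (partial c t N) z <> RtoC 0).
  { destruct (excluded_middle_informative (exists k, t k = (u, v))) as [[k E] | E].
    - destruct (no_zero_near_pole k) as (r & Hr & H).
      exists r, (S k); split; [exact Hr|].
      intros N z HN Hz; apply H; [lia | now rewrite E].
    - assert (Hz0 : forall n, (u, v) <> t n) by (intros n En; apply E; now exists n).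
      destruct (no_zero_near_regular (u, v) Hz0) as (r & N0 & Hr & H).
      + intros Hs; apply (Hno (u, v)); now split.
      + exists r, N0; split; [exact Hr|]; auto. }
  destruct H as (r & N0 & Hr & H).
  assert (HN0 : 0 < INR N0 + 1) by (pose proof (pos_INR N0); lra).
  assert (Hd : 0 < Rmin (r / 2) (/ (INR N0 + 1))).
  { apply Rmin_glb_lt; [lra | now apply Rinv_0_lt_compat]. }
  exists (mkposreal _ Hd); intros N z HN H1 H2; simpl in *.
  apply H.
  - apply INR_le; apply Rle_trans with (INR N0 + 1); [lra|].
    rewrite <- (Rinv_inv (INR N0 + 1)).
    eapply Rle_trans; [|exact HN]; apply Rinv_le_contravar; [exact Hd | apply Rmin_r].
  - pose proof (Rmin_l (r / 2) (/ (INR N0 + 1))).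
    pose proof (Cmod_le_add (z - (u, v))) as H'.
    change (fst (z - (u, v))%C) with (fst z - u) in H'.
    change (snd (z - (u, v))%C) with (snd z - v) in H'; lra. }
assert (Hch : forall uv : R * R, exists d : posreal, forall N z,
  / d <= INR N -> Rabs (fst z - fst uv) < d -> Rabs (snd z - snd uv) < d ->
  ~ In z (map t (seq 0 N)) -> psum (partial c t N) z <> RtoC 0)
  by (intros [u v]; apply Hloc).
set (delta := fun uv => proj1_sig (constructive_indefinite_description _ (Hch uv))).
destruct (compactness_value_2d (- B) B (- B) B (fun u v => delta (u, v))) as [d Hd].
destruct (INR_unbounded (/ d)) as [N0 HN0].
exists N0; intros N w HN Hw H0.
destruct (Rle_dec B (Cmod w)) as [Hle | Hlt]; [exact Hle | exfalso].
pose proof (re_le_Cmod w) as Hre; pose proof (im_le_Cmod w) as Him.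
unfold Re, Im in Hre, Him; apply Rabs_le_between in Hre, Him.
(* Compactness supplies the covering point under a double negation, which is enough since the goal
   is [False]. *)
apply (Hd (fst w) (snd w)); [lra | lra|].
intros (u & v & _ & _ & Hu & Hv & Hduv).
unfold delta in Hu, Hv, Hduv.
destruct (constructive_indefinite_description _ (Hch (u, v))) as [e He]; simpl in *.
apply (He N w); auto.
apply Rle_trans with (/ d).
- apply Rinv_le_contravar; [apply cond_pos | exact Hduv].
- apply le_INR in HN; lra.
Qed.
End Escape.

(** * Contradiction *)

Lemma lprod_seq_ge_exp (g : C -> R) (t : nat -> C) (e : nat -> R) (N : nat) :
  (forall n, exp (- e n) <= g (t n)) ->
  exp (- rsum e N) <= lprod g (map t (seq 0 N)).
Proof.
intros H; induction N as [|N IH].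
- simpl; rewrite Ropp_0, exp_0; lra.
- rewrite seq_S, map_app, lprod_app; simpl.
  rewrite Ropp_plus_distr, exp_plus, Rmult_1_r.
  apply Rmult_le_compat; auto; apply Rlt_le, exp_pos.
Qed.

Lemma exp_le_mono (u v : R) : exp u <= exp v <-> u <= v.
Proof.
split; intros H; apply Rnot_lt_le; intros H'.
- apply exp_increasing in H'; lra.
- apply exp_lt_inv in H'; lra.
Qed.

Lemma exp_le_inv_sq (u : R) : 0 <= u -> exp (- (2 * u)) <= (/ (1 + u)) ^ 2.
Proof.
intros Hu; rewrite pow_inv, exp_Ropp; apply Rinv_le_contravar; [apply pow_lt; lra|].
replace (2 * u) with (u + u) by ring; rewrite exp_plus.
pose proof (exp_ineq1_le u); simpl; rewrite Rmult_1_r; apply Rmult_le_compat; lra.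
Qed.

(* The first [M] factors are only exponential in [x]; the Gaussian rate comes from the tail. *)
Lemma lprod_quot_ge (t : nat -> C) (x E eps : R) (M K : nat) :
  (forall n, cone (t n)) -> 0 < x -> 0 <= E ->
  (forall n, 1 / Cmod (t n) ^ 2 <= E ^ 2) ->
  rsum (fun n => 1 / Cmod (t n) ^ 2) (M + K)
    - rsum (fun n => 1 / Cmod (t n) ^ 2) M <= eps ->
  exp (- (INR M * (4 * E * x) + 2 * x ^ 2 * eps))
  <= lprod (quot x) (map t (seq 0 (M + K))).
Proof.
intros Ht Hx HE0 HE Heps.
set (s := fun n => 1 / Cmod (t n) ^ 2) in *.
assert (Hs : forall n, 0 < s n).
{ intros n; unfold s; apply Rdiv_lt_0_compat; [lra|]; apply pow_lt, Cmod_gt_0.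
  intros E0; destruct (Ht n) as [H _]; rewrite E0 in H; simpl in H; lra. }
(* For the head, (1 + x^2 s)^-2 >= (1 + E x)^-4 >= exp(-4 E x); the tail uses exp(-2 x^2 s). *)
set (e := fun n => if lt_dec n M then 4 * E * x else 2 * (x ^ 2 * s n)).
apply Rle_trans with (exp (- rsum e (M + K))).
- apply exp_le_mono; apply Ropp_le_contravar.
  assert (H1 : forall k, (k <= M)%nat -> rsum e k = INR k * (4 * E * x)).
  { induction k as [|k IH]; intros Hk; [simpl; ring|].
    rewrite S_INR; cbn [rsum]; rewrite IH by lia; unfold e.
    destruct (lt_dec k M); [ring | lia]. }
  assert (H2 : forall k, rsum e (M + k)
    = INR M * (4 * E * x) + 2 * x ^ 2 * (rsum s (M + k) - rsum s M)).
  { induction k as [|k IH]; [rewrite Nat.add_0_r, H1 by lia; ring|].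
    rewrite Nat.add_succ_r; cbn [rsum]; rewrite IH; unfold e.
    destruct (lt_dec (M + k) M); [lia | ring]. }
  rewrite H2; apply Rplus_le_compat_l, Rmult_le_compat_l; [nra | exact Heps].
- apply lprod_seq_ge_exp; intros n.
  eapply Rle_trans; [|apply quot_ge; auto].
  fold (s n); specialize (Hs n); specialize (HE n); fold (s n) in HE.
  unfold e; destruct (lt_dec n M).
  + assert (HEx : 0 <= E * x) by (apply Rmult_le_pos; lra).
    pose proof (exp_le_inv_sq (E * x) HEx) as H.
    replace (- (4 * E * x)) with (- (2 * (E * x)) + - (2 * (E * x))) by ring.
    rewrite exp_plus.
    apply Rle_trans with ((/ (1 + E * x)) ^ 2 * (/ (1 + E * x)) ^ 2).
    * pose proof (exp_pos (- (2 * (E * x)))); apply Rmult_le_compat; lra.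
    * rewrite <- Rpow_mult_distr; apply pow_incr; split.
      { apply Rmult_le_pos; apply Rlt_le, Rinv_0_lt_compat; lra. }
      rewrite <- Rinv_mult; apply Rinv_le_contravar; nra.
  + apply exp_le_inv_sq; apply Rmult_le_pos; [nra | lra].
Qed.

Lemma exp_scale_choice (K k : R) : 0 < K ->
  exists x, 1 <= x /\ K / x ^ 2 <= exp (- k).
Proof.
intros HK; set (x := 1 + K * exp k).
assert (Hk : 0 < K * exp k) by (apply Rmult_lt_0_compat; [lra | apply exp_pos]).
exists x; unfold x; split; [lra|].
apply Rle_div_l; [apply Rlt_gt, pow_lt; lra|].
apply Rle_trans with (exp (- k) * (K * exp k)).
- replace (exp (- k) * (K * exp k)) with (K * (exp (- k) * exp k)) by ring.
  rewrite <- exp_plus, Rplus_opp_l, exp_0; lra.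
- apply Rmult_le_compat_l; [apply Rlt_le, exp_pos | nra].
Qed.

Theorem theorem13 (t : nat -> C) (c : nat -> R)
  (ht0 : forall n : nat, t n <> RtoC 0)
  (htlim : is_lim_seq (fun n : nat => Cmod (t n)) p_infty)
  (hc : forall n : nat, 0 < c n)
  (harg : forall n : nat, Rabs (Carg (t n)) < PI / 8)
  (hsum1 : ex_series (fun n : nat => c n / Cmod (t n)))
  (hsum2 : ex_series (fun n : nat => 1 / Cmod (t n) ^ 2)) :
  exists z : C, is_pole_series c t z (RtoC 0).
Proof.
apply NNPP; intros Hno0.
assert (Hno : forall z, ~ is_pole_series c t z (RtoC 0))
  by (intros z Hz; apply Hno0; now exists z).
clear Hno0.
assert (Hcone : forall n, cone (t n)) by (intros n; now apply arg_cone).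
destruct hsum1 as [T HT].
assert (Hmod : forall n, 0 < Cmod (t n)) by (intros n; now apply Cmod_gt_0).
assert (HTpos : 0 < T).
{ pose proof (ratio_rsum t c T ht0 hc HT 1) as H; simpl in H.
  pose proof (ratio_pos t c ht0 hc 0); lra. }
(* From the term of index 0: u + x <= (1 + u)(1 + x) turns its lower bound into m / (1 + x). *)
set (m := 4 / 5 * c 0%nat / (1 + fst (t 0%nat))).
destruct (Hcone 0%nat) as [Ht0 _].
assert (Hm : 0 < m) by (apply Rdiv_lt_0_compat; [pose proof (hc 0%nat)|]; lra).
assert (Hlarge : forall B, exists n, B < Cmod (t n)).
{ intros B; destruct (modulus_large t htlim B) as [n Hn]; exists n; now apply Hn. }
(* Strictly increasing moduli guarantee three distinct poles. *)
destruct (Hlarge (Cmod (t 0%nat))) as [n1 Hn1].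
destruct (Hlarge (Cmod (t n1))) as [n2 Hn2].
set (l := [t 0%nat; t n1; t n2]).
assert (Hl : NoDup l).
{ repeat constructor; simpl; intros H; decompose [or] H; auto;
  match goal with E : t _ = t _ |- _ => rewrite E in *; lra end. }
set (P := lprod (fun z => 4 * Cmod z ^ 2) l).
assert (HP : 0 < P).
{ apply lprod_pos; intros z [<- | [<- | [<- | []]]];
  (apply Rmult_lt_0_compat; [lra | now apply pow_lt]). }
assert (HTm : 0 < (T / m) ^ 4) by now apply pow_lt, Rdiv_lt_0_compat.
(* The upper bound has (1 + x)^4 <= 16 x^4 and the three poles give P / x^6, so x^-2 remains and is
   pushed below exp(-1). *)
destruct (exp_scale_choice ((T / m) ^ 4 * 16 * P) 1) as (x & Hx1 & Hx).
{ apply Rmult_lt_0_compat; lra. }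
assert (Hx2 : 0 < x ^ 2) by (apply pow_lt; lra).
(* The two estimates will read 1 <= 2 x^2 S0 and S0 <= 40 eps; this choice makes 80 x^2 eps = 4/5 <
   1. *)
set (eps := / (100 * x ^ 2)).
assert (Heps : 0 < eps) by (apply Rinv_0_lt_compat; lra).
set (s := fun n => 1 / Cmod (t n) ^ 2).
assert (Hs : forall n, 0 <= s n).
{ intros n; apply Rlt_le, Rdiv_lt_0_compat; [lra | now apply pow_lt]. }
destruct (rsum_tail s eps Hs hsum2 Heps) as [M HM].
destruct (modulus_lower t ht0 htlim) as (mu & Hmu & Hmun).
set (E := / mu).
assert (HE0 : 0 < E) by now apply Rinv_0_lt_compat.
assert (HE : forall n, s n <= E ^ 2).
{ intros n; unfold s, E, Rdiv; rewrite Rmult_1_l, pow_inv.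
  apply Rinv_le_contravar; [now apply pow_lt | apply pow_incr].
  split; [lra | apply Hmun]. }
set (k := - ln ((m / T) ^ 4)).
(* Collects every loss at most linear in y: the constant (m / T)^4, the factor (1 + 2y)^-2 >=
   exp(-4y), and the first M poles. Taking y > b / eps bounds them all by eps y^2. *)
set (b := Rabs k + 4 + 4 * E * INR M).
assert (Hb : 0 < b).
{ pose proof (Rabs_pos k); pose proof (pos_INR M).
  assert (0 <= 4 * E * INR M) by (apply Rmult_le_pos; lra). unfold b; lra. }
set (y := 1 + b / eps).
assert (Hbe : 0 < b / eps) by now apply Rdiv_lt_0_compat.
assert (Hy : 1 <= y) by (unfold y; lra).
destruct (zeros_escape t c T ht0 htlim hc HT Hno y) as [N0 HN0].
(* Long enough to contain the three poles, to send all zeros beyond y, and to split off the first M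
   poles. *)
set (N := (M + (N0 + n1 + n2 + 1))%nat).
set (L := partial c t N).
assert (HLc : weights_pos L).
{ intros p Hp; apply partial_inv in Hp as [n ->]; apply hc. }
assert (HLt : forall p, In p L -> cone (snd p)).
{ intros p Hp; apply partial_inv in Hp as [n ->]; apply Hcone. }
assert (HL0 : In (c 0%nat, t 0%nat) L) by (apply in_partial; unfold N; lia).
destruct (zeros_bounds L m T HLc) as (ws & Hw & Hlow & Hup); auto.
{ intros EL; now rewrite EL in HL0. }
{ intros u Hu; split.
  - eapply Rle_trans; [|apply psum_neg_lower with (1 := HLc) (2 := HLt) (3 := Hu) (4 := HL0)].
    unfold m; pose proof (hc 0%nat).
    apply Rle_trans with (4 / 5 * c 0%nat * / ((1 + fst (t 0%nat)) * (1 + u))).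
    + apply Req_le; field; lra.
    + apply Rmult_le_compat_l; [lra | apply Rinv_le_contravar; nra].
  - eapply Rle_trans; [now apply psum_neg_upper|].
    unfold L; rewrite lsum_partial; now apply ratio_rsum. }
set (S0 := lsum (fun w => 1 / Cmod w ^ 2) ws) in *.
assert (HS1 : 1 <= 2 * x ^ 2 * S0).
{ assert (Hincl : incl l (map snd L)).
  { unfold L; rewrite snd_partial.
    intros z [<- | [<- | [<- | []]]]; apply in_map, in_seq; unfold N; lia. }
  pose proof (Hlow x l ltac:(lra) Hl Hincl) as H.
  assert (HQ : lprod (quot x) l <= P / x ^ 6).
  { replace (P / x ^ 6) with (lprod (fun z => 4 * Cmod z ^ 2 / x ^ 2) l)
      by (unfold P, l; simpl; field; lra).
    apply lprod_le; intros z [<- | [<- | [<- | []]]];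
    (split; [apply Rlt_le, quot_pos | apply quot_le_inv]); auto; lra. }
  assert (HX : (T / m * (1 + x)) ^ 4 <= (T / m) ^ 4 * 16 * x ^ 4).
  { rewrite Rpow_mult_distr, Rmult_assoc; apply Rmult_le_compat_l; [lra|].
    replace (16 * x ^ 4) with ((2 * x) ^ 4) by ring; apply pow_incr; lra. }
  assert (H6 : 0 < P / x ^ 6) by (apply Rdiv_lt_0_compat; [lra | apply pow_lt; lra]).
  enough (He : exp (- (2 * x ^ 2) * S0) <= exp (- 1)).
  { apply (proj1 (exp_le_mono _ _)) in He; lra. }
  eapply Rle_trans; [exact H|]; eapply Rle_trans; [|exact Hx].
  apply Rle_trans with ((T / m) ^ 4 * 16 * x ^ 4 * (P / x ^ 6)).
  - apply Rmult_le_compat; auto.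
    + apply pow_le, Rmult_le_pos; [apply Rlt_le, Rdiv_lt_0_compat|]; lra.
    + apply Rlt_le, lprod_pos; intros z [<- | [<- | [<- | []]]]; apply quot_pos; auto; lra.
  - apply Req_le; field; lra. }
(* Of the 3 eps, two come from the tail of the poles and one from the linear losses gathered in
   [b]. *)
assert (HS2 : 3 / 40 * S0 <= 3 * eps).
{ assert (Hwy : forall w, In w ws -> y <= Cmod w).
  { intros w Hin; destruct (Hw w Hin) as [H1 H2].
    unfold L in H1; rewrite snd_partial in H1.
    apply (HN0 N); auto; unfold N; lia. }
  pose proof (Hup y ltac:(lra) Hwy) as H.
  unfold L in H; rewrite snd_partial in H.
  pose proof (lprod_quot_ge t y E eps M (N0 + n1 + n2 + 1) Hcone ltac:(lra)
    ltac:(lra) HE (HM _)) as HQ; fold N in HQ.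
  assert (Hk : (m / T) ^ 4 = exp (- k)).
  { unfold k; rewrite Ropp_involutive, exp_ln; [reflexivity|].
    now apply pow_lt, Rdiv_lt_0_compat. }
  pose proof (exp_le_inv_sq (2 * y) ltac:(lra)) as Hy2.
  assert (He : exp (- k + - (2 * (2 * y)) + - (INR M * (4 * E * y) + 2 * y ^ 2 * eps))
    <= exp (- (3 / 40 * y ^ 2) * S0)).
  { eapply Rle_trans; [|exact H]; rewrite !exp_plus, Hk.
    unfold Rdiv; rewrite <- pow_inv.
    pose proof (exp_pos (- k)); pose proof (exp_pos (- (2 * (2 * y)))).
    pose proof (exp_pos (- (INR M * (4 * E * y) + 2 * y ^ 2 * eps))) as Hp.
    apply Rmult_le_compat; [apply Rmult_le_pos; lra | lra | | exact HQ].
    apply Rmult_le_compat_l; lra. }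
  apply (proj1 (exp_le_mono _ _)) in He.
  assert (Hby : b <= eps * y).
  { unfold y; rewrite Rmult_plus_distr_l, Rmult_1_r.
    replace (eps * (b / eps)) with b by (field; lra); lra. }
  assert (Hbyy : b * y <= eps * y * y) by (apply Rmult_le_compat_r; lra).
  assert (Hk1 : k <= Rabs k * y).
  { pose proof (Rle_abs k); pose proof (Rabs_pos k); nra. }
  assert (Hy0 : 0 < y ^ 2) by (apply pow_lt; lra).
  apply Rmult_le_reg_l with (1 := Hy0).
  unfold b in Hbyy; simpl in *; lra. }
assert (Hc1 : eps * (100 * x ^ 2) = 1) by (unfold eps; field; lra).
assert (x ^ 2 * (3 / 40 * S0) <= x ^ 2 * (3 * eps)) by (apply Rmult_le_compat_l; lra).
lra.
Qed.
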